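(* Let $f=h+\overline{g}\in\mathcal{S}^0(H_\pi)$ have dilatation $\omega(z)=g'(z)/h'(z)=e^{i\theta}z^n$, where $n\in\{1,2\}$ and $\theta\in\mathbb{R}$. Then $f_0\ast f\in\mathcal{S}_H^0$.
   Context: Let $\mathbb{D}=\{z\in\mathbb{C}:|z|<1\}$. $\mathcal{H}$ is the class of complex-valued harmonic functions $f=h+\overline{g}$ on $\mathbb{D}$ with $h,g$ analytic on $\mathbb{D}$ of the form $h(z)=z+\sum_{n\ge2}a_nz^n$, $g(z)=\sum_{n\ge1}b_nz^n$. The complex dilatation of $f$ is $\omega=g'/h'$. $\mathcal{S}_H$ is the class of univalent sense-preserving $f\in\mathcal{H}$ (sense-preserving: $|h'(z)|^2-|g'(z)|^2>0$ in $\mathbb{D}$), and $\mathcal{S}_H^0=\{f\in\mathcal{S}_H: b_1=f_{\overline z}(0)=0\}$. For $0\le\gamma<2\pi$, let $H_\gamma=\{w\in\mathbb{C}:\operatorname{Re}(e^{i\gamma}w)>-1/2\}$, and let $\mathcal{S}^0(H_\gamma)$ be the class of all $f\in\mathcal{S}_H^0$ with $f(\mathbb{D})=H_\gamma$; in particular $H_\pi=\{w:\operatorname{Re}w<1/2\}$. The harmonic convolution of $f=h+\overline g$ and $F=H+\overline G$ in $\mathcal{H}$, with $H(z)=z+\sum_{n\ge2}A_nz^n$, $G(z)=\sum_{n\ge1}B_nz^n$, is $(f\ast F)(z)=z+\sum_{n\ge2}a_nA_nz^n+\sum_{n\ge1}\overline{b_nB_n}\,\overline{z}^{\,n}$. Fix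 $f_0=h_0+\overline{g_0}$ with $h_0(z)=\frac{z-z^2/2}{(1-z)^2}$ and $g_0(z)=\frac{-z^2/2}{(1-z)^2}$. *)

(* Defs.v *)
From Stdlib Require Import Reals Lra Lia Psatz.
From Coquelicot Require Import Coquelicot.

Open Scope R_scope.

Definition in_disk (z : C) : Prop := Cmod z < 1.

(** [h] is the sum of the power series with coefficients [a] on the disk. *)
Definition sums_to_on_disk (a : nat -> C) (h : C -> C) : Prop :=
  forall z : C, in_disk z ->
    is_pseries (K := C_AbsRing) (V := C_NormedModule) a z (h z).

(** The class of harmonic [f = h + conj g] with [h, g] analytic on the disk,
    [h(z) = z + a_2 z^2 + ...], [g(z) = b_1 z + b_2 z^2 + ...].  The values of
    [h] and [g] outside the disk are irrelevant; on the disk, [h], [g] and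
    their coefficients determine each other. *)
Record harmonic : Type := Harmonic {
  hpart : C -> C;
  gpart : C -> C;
  hcoef : nat -> C;
  gcoef : nat -> C;
  hcoef_0 : hcoef 0%nat = RtoC 0;
  hcoef_1 : hcoef 1%nat = RtoC 1;
  gcoef_0 : gcoef 0%nat = RtoC 0;
  hpart_series : sums_to_on_disk hcoef hpart;
  gpart_series : sums_to_on_disk gcoef gpart
}.

Definition harmonic_eval (f : harmonic) (z : C) : C :=
  (hpart f z + Cconj (gpart f z))%C.

Coercion harmonic_eval : harmonic >-> Funclass.

(** [C_derive] is a total operator; on analytic functions it agrees with the
    complex derivative ([is_C_derive_unique]). *)
Definition dilatation (f : harmonic) (z : C) : C :=
  (C_derive (gpart f) z / C_derive (hpart f) z)%C.

Definition sense_preserving (f : harmonic) : Prop :=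
  forall z : C, in_disk z ->
    Cmod (C_derive (hpart f) z) ^ 2 - Cmod (C_derive (gpart f) z) ^ 2 > 0.

Definition univalent (f : harmonic) : Prop :=
  forall z w : C, in_disk z -> in_disk w -> f z = f w -> z = w.

Definition S_H (f : harmonic) : Prop := univalent f /\ sense_preserving f.

Definition S_H0 (f : harmonic) : Prop := S_H f /\ gcoef f 1%nat = RtoC 0.

Definition expi (t : R) : C := (cos t, sin t).

Definition halfplane (gamma : R) (w : C) : Prop :=
  Re (expi gamma * w)%C > - (1 / 2).

Lemma halfplane_PI (w : C) : halfplane PI w <-> Re w < 1 / 2.
Proof.
unfold halfplane, expi; rewrite cos_PI, sin_PI, re_mult; simpl; lra.
Qed.

(** The second conjunct is [f(D) = H_gamma]. *)
Definition S0_halfplane (gamma : R) (f : harmonic) : Prop :=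
  S_H0 f /\
  forall w : C, (exists z : C, in_disk z /\ f z = w) <-> halfplane gamma w.

(** Complex counterpart of [PSeries]: the sum where the series converges. *)
Definition C_PSeries (a : nat -> C) (z : C) : C :=
  @iota C_CompleteNormedModule
    (fun l : C => is_pseries (K := C_AbsRing) (V := C_NormedModule) a z l).

Lemma pow_n_Cpow (z : C) (n : nat) : @pow_n C_Ring z n = (z ^ n)%C.
Proof. induction n as [|n IH]; [reflexivity|]. simpl. now rewrite IH. Qed.

Lemma is_Cpseries_unique (a : nat -> C) (z l l' : C) :
  is_pseries (K := C_AbsRing) (V := C_NormedModule) a z l ->
  is_pseries (K := C_AbsRing) (V := C_NormedModule) a z l' -> l = l'.
Proof.
intros H H'.
exact (@filterlim_locally_unique nat C_AbsRing C_NormedModule eventually _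
         _ l l' H H').
Qed.

Lemma C_PSeries_correct (a : nat -> C) (z : C) :
  ex_pseries (K := C_AbsRing) (V := C_NormedModule) a z ->
  is_pseries (K := C_AbsRing) (V := C_NormedModule) a z (C_PSeries a z).
Proof.
intros [l Hl].
apply (@iota_correct C_AbsRing C_CompleteNormedModule
  (fun l : C => is_pseries (K := C_AbsRing) (V := C_NormedModule) a z l)).
exists l; split; [exact Hl|].
intros l' Hl'; exact (is_Cpseries_unique a z l l' Hl Hl').
Qed.

Definition subexponential (a : nat -> C) : Prop :=
  forall r : R, 0 < r < 1 ->
    exists M : R, forall n : nat, Cmod (a n) * r ^ n <= M.

Lemma subexponential_ex_pseries (a : nat -> C) (z : C) :
  subexponential a -> in_disk z ->
  ex_pseries (K := C_AbsRing) (V := C_NormedModule) a z.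
Proof.
unfold in_disk; intros Ha Hz.
pose proof (Cmod_ge_0 z) as Hz0.
set (r := (1 + Cmod z) / 2).
assert (Hr : 0 < r < 1) by (unfold r; lra).
assert (Hzr : Cmod z < r) by (unfold r; lra).
destruct (Ha r Hr) as [M HM].
apply (@ex_series_le C_AbsRing C_CompleteNormedModule
         (fun n => @scal C_AbsRing C_NormedModule (@pow_n C_AbsRing z n) (a n))
         (fun n => M * (Cmod z / r) ^ n)).
- intros n.
  change (Cmod (@pow_n C_Ring z n * a n)%C <= M * (Cmod z / r) ^ n).
  rewrite pow_n_Cpow, Cmod_mult, Cmod_pow.
  assert (Hrn : r ^ n > 0) by (apply pow_lt; lra).
  unfold Rdiv; rewrite Rpow_mult_distr, pow_inv.
  replace (Cmod z ^ n * Cmod (a n))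
    with (Cmod (a n) * r ^ n * (Cmod z ^ n * / r ^ n)) by (field; lra).
  apply Rmult_le_compat_r; [|apply HM].
  apply Rmult_le_pos; [now apply pow_le|].
  left; now apply Rinv_0_lt_compat.
- apply (ex_series_scal (V := R_NormedModule) M).
  apply ex_series_geom.
  assert (Hq : 0 <= Cmod z / r < 1).
  { split; [apply Rdiv_le_0_compat; lra|].
    apply Rmult_lt_reg_r with r; [lra|]. field_simplify; lra. }
  rewrite Rabs_pos_eq; lra.
Qed.

Lemma sums_to_on_disk_subexponential (a : nat -> C) (h : C -> C) :
  sums_to_on_disk a h -> subexponential a.
Proof.
intros H r Hr.
assert (Hd : in_disk (RtoC r)).
{ unfold in_disk; rewrite Cmod_R, Rabs_pos_eq; lra. }
specialize (H _ Hd).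
set (t := fun n => @scal C_AbsRing C_NormedModule (@pow_n C_AbsRing (RtoC r) n) (a n)).
destruct (@filterlim_bounded C_AbsRing C_NormedModule (sum_n t)
            (ex_intro _ _ H)) as [M HM].
assert (Ht : forall n, Cmod (a n) * r ^ n = Cmod (t n)).
{ intros n.
  change (t n) with (@pow_n C_Ring (RtoC r) n * a n)%C.
  rewrite pow_n_Cpow, Cmod_mult, Cmod_pow, Cmod_R, Rabs_pos_eq by lra.
  ring. }
exists (2 * M); intros n; rewrite Ht.
destruct n as [|n].
- specialize (HM 0%nat); rewrite sum_O in HM.
  change (Cmod (t 0%nat) <= M) in HM.
  pose proof (Cmod_ge_0 (t 0%nat)); lra.
- pose proof (HM n) as H1; pose proof (HM (S n)) as H2.
  rewrite sum_Sn in H2.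
  change (Cmod (sum_n t n) <= M) in H1.
  change (Cmod (sum_n t n + t (S n))%C <= M) in H2.
  replace (t (S n)) with ((sum_n t n + t (S n)) + - sum_n t n)%C by ring.
  pose proof (Cmod_triangle (sum_n t n + t (S n)) (- sum_n t n)) as H3.
  rewrite Cmod_opp in H3; lra.
Qed.

Lemma subexponential_mult (a b : nat -> C) :
  subexponential a -> subexponential b ->
  subexponential (fun n => (a n * b n)%C).
Proof.
intros Ha Hb r Hr.
assert (Hs0 : 0 < sqrt r) by (apply sqrt_lt_R0; lra).
assert (Hss : sqrt r * sqrt r = r) by (apply sqrt_sqrt; lra).
assert (Hs1 : sqrt r < 1) by nra.
destruct (Ha _ (conj Hs0 Hs1)) as [M HM].
destruct (Hb _ (conj Hs0 Hs1)) as [N HN].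
exists (M * N); intros n.
rewrite Cmod_mult.
replace (r ^ n) with (sqrt r ^ n * sqrt r ^ n)
  by now rewrite <- Rpow_mult_distr, Hss.
replace (Cmod (a n) * Cmod (b n) * (sqrt r ^ n * sqrt r ^ n))
  with ((Cmod (a n) * sqrt r ^ n) * (Cmod (b n) * sqrt r ^ n)) by ring.
assert (0 <= sqrt r ^ n) by (apply pow_le; lra).
apply Rmult_le_compat; auto using Rmult_le_pos, Cmod_ge_0.
Qed.

Lemma sums_to_on_disk_hadamard (a b : nat -> C) (h k : C -> C) :
  sums_to_on_disk a h -> sums_to_on_disk b k ->
  sums_to_on_disk (fun n => (a n * b n)%C)
    (C_PSeries (fun n => (a n * b n)%C)).
Proof.
intros Ha Hb z Hz.
apply C_PSeries_correct, subexponential_ex_pseries; [|exact Hz].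
apply subexponential_mult; eapply sums_to_on_disk_subexponential; eassumption.
Qed.

Lemma convolution_hcoef_0 (f F : harmonic) :
  (hcoef f 0%nat * hcoef F 0%nat)%C = RtoC 0.
Proof. rewrite hcoef_0; ring. Qed.

Lemma convolution_hcoef_1 (f F : harmonic) :
  (hcoef f 1%nat * hcoef F 1%nat)%C = RtoC 1.
Proof. rewrite !hcoef_1; ring. Qed.

Lemma convolution_gcoef_0 (f F : harmonic) :
  (gcoef f 0%nat * gcoef F 0%nat)%C = RtoC 0.
Proof. rewrite gcoef_0; ring. Qed.

(** The co-analytic part [sum conj(b_n B_n) conj(z)^n] is the conjugate of
    [sum b_n B_n z^n]. *)
Definition convolution (f F : harmonic) : harmonic :=
  Harmonic
    (C_PSeries (fun n => (hcoef f n * hcoef F n)%C))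
    (C_PSeries (fun n => (gcoef f n * gcoef F n)%C))
    (fun n => (hcoef f n * hcoef F n)%C)
    (fun n => (gcoef f n * gcoef F n)%C)
    (convolution_hcoef_0 f F)
    (convolution_hcoef_1 f F)
    (convolution_gcoef_0 f F)
    (sums_to_on_disk_hadamard _ _ _ _ (hpart_series f) (hpart_series F))
    (sums_to_on_disk_hadamard _ _ _ _ (gpart_series f) (gpart_series F)).

Definition h0 (z : C) : C := ((z - z ^ 2 / 2) / (1 - z) ^ 2)%C.
Definition g0 (z : C) : C := (- (z ^ 2) / 2 / (1 - z) ^ 2)%C.

(** Since [sum n z^n = z / (1 - z)^2], on the disk
    [h0 z = sum_(n >= 1) (n + 1)/2 z^n] and [g0 z = sum_(n >= 1) (1 - n)/2 z^n]. *)
Definition h0_coef (n : nat) : C :=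
  match n with O => RtoC 0 | S _ => RtoC ((INR n + 1) / 2) end.
Definition g0_coef (n : nat) : C :=
  match n with O => RtoC 0 | S _ => RtoC ((1 - INR n) / 2) end.

Lemma subexponential_linear (a : nat -> C) :
  (forall n, Cmod (a n) <= INR n + 1) -> subexponential a.
Proof.
intros Ha r Hr.
exists (/ (1 - r)); intros n.
assert (Hi : 0 < / r) by (apply Rinv_0_lt_compat; lra).
assert (Hrn : 0 < r ^ n) by (apply pow_lt; lra).
assert (Hb : (INR n + 1) * r ^ n * (1 - r) <= 1 - r * r ^ n).
{ clear Ha Hi Hrn. induction n as [|n IH]; [simpl; lra|].
  assert (r ^ n <= 1) by (rewrite <- (pow1 n); apply pow_incr; lra).
  assert (0 < r ^ n) by (apply pow_lt; lra).
  rewrite S_INR; change (r ^ S n) with (r * r ^ n).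
  apply Rmult_le_compat_l with (r := r) in IH; [|lra].
  assert (r * r ^ n <= 1) by nra.
  assert (r * r ^ n * (1 - r) <= 1 * (1 - r)) by (apply Rmult_le_compat_r; lra).
  lra. }
apply Rle_trans with ((INR n + 1) * r ^ n).
- apply Rmult_le_compat_r; [lra|apply Ha].
- apply Rmult_le_reg_r with (1 - r); [lra|].
  rewrite Rinv_l; [|lra].
  assert (0 < r * r ^ n) by (apply Rmult_lt_0_compat; lra).
  lra.
Qed.

Definition backward_difference (a : nat -> C) (n : nat) : C :=
  match n with O => a 0%nat | S m => (a n - a m)%C end.

Lemma is_Cpseries_backward_difference (a : nat -> C) (z l : C) :
  is_pseries (K := C_AbsRing) (V := C_NormedModule) a z l ->
  is_pseries (K := C_AbsRing) (V := C_NormedModule)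
    (backward_difference a) z ((1 - z) * l)%C.
Proof.
intros H.
pose proof (@is_pseries_minus C_AbsRing C_NormedModule _ _ z _ _ H
              (@is_pseries_incr_1 C_AbsRing C_NormedModule a z l H)) as Hm.
replace ((1 - z) * l)%C with (@minus C_NormedModule l (@scal C_AbsRing C_NormedModule z l)).
- eapply is_pseries_ext; [|exact Hm].
  intros [|n].
  + change (a 0%nat + - 0 = a 0%nat)%C; ring.
  + reflexivity.
- change (l + - (z * l) = (1 - z) * l)%C; ring.
Qed.

Lemma is_Cpseries_quadratic (a : nat -> C) (z : C) :
  (forall n, a (3 + n)%nat = RtoC 0) ->
  is_pseries (K := C_AbsRing) (V := C_NormedModule) a z
    (a 0%nat + z * a 1%nat + z ^ 2 * a 2%nat)%C.
Proof.
intros Ha.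
apply filterlim_ext_loc with
  (fun _ : nat => (a 0%nat + z * a 1%nat + z ^ 2 * a 2%nat)%C);
  [|apply filterlim_const].
exists 2%nat; intros n Hn.
replace n with (2 + (n - 2))%nat by lia.
generalize (n - 2)%nat as m; clear n Hn.
induction m as [|m IH].
- change (2 + 0)%nat with 2%nat; rewrite !sum_Sn, sum_O.
  change (a 0%nat + z * a 1%nat + z ^ 2 * a 2%nat
          = 1 * a 0%nat + z * 1 * a 1%nat + z * (z * 1) * a 2%nat)%C.
  ring.
- replace (2 + S m)%nat with (S (2 + m)) by lia.
  rewrite sum_Sn, <- IH.
  replace (a (S (2 + m))) with (RtoC 0) by (symmetry; apply (Ha m)).
  match goal with |- ?x = plus _ (scal ?w _) => change (x = x + w * 0)%C end.
  ring.
Qed.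

Lemma sums_to_on_disk_double_pole (a : nat -> C) (h : C -> C) :
  (forall n, Cmod (a n) <= INR n + 1) ->
  (forall n, backward_difference (backward_difference a) (3 + n)%nat = RtoC 0) ->
  (forall z, h z = ((a 0%nat + z * (a 1%nat - a 0%nat - a 0%nat)
     + z ^ 2 * (a 2%nat - a 1%nat - (a 1%nat - a 0%nat))) / (1 - z) ^ 2)%C) ->
  sums_to_on_disk a h.
Proof.
intros Hb Ha Hh z Hz.
assert (Hex : exists l : C,
  is_pseries (K := C_AbsRing) (V := C_NormedModule) a z l)
  by exact (subexponential_ex_pseries a z (subexponential_linear a Hb) Hz).
destruct Hex as [l Hl].
replace (h z) with l; [exact Hl|].
pose proof (is_Cpseries_backward_difference _ _ _
              (is_Cpseries_backward_difference _ _ _ Hl)) as H1.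
pose proof (is_Cpseries_unique _ _ _ _ H1 (is_Cpseries_quadratic _ z Ha)) as H2.
simpl in H2; rewrite Hh; simpl; rewrite <- H2.
field.
intros H0; unfold in_disk in Hz.
replace z with (RtoC 1) in Hz by (replace z with (1 - (1 - z))%C by ring; rewrite H0; ring).
rewrite Cmod_1 in Hz; lra.
Qed.

Lemma h0_series : sums_to_on_disk h0_coef h0.
Proof.
apply sums_to_on_disk_double_pole.
- intros [|n]; unfold h0_coef; rewrite Cmod_R.
  + rewrite Rabs_R0; simpl; lra.
  + pose proof (pos_INR (S n)); rewrite Rabs_pos_eq; lra.
- intros n; cbn -[INR]; rewrite !S_INR, <- !RtoC_minus; f_equal; field.
- intros z; unfold h0; cbn -[Cpow]; f_equal.
  rewrite <- !RtoC_minus.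
  replace ((1 + 1) / 2 - 0 - 0) with 1 by field.
  replace ((1 + 1 + 1) / 2 - (1 + 1) / 2 - ((1 + 1) / 2 - 0)) with (- (1 / 2)) by field.
  rewrite RtoC_opp, RtoC_div by lra; field.
Qed.

Lemma g0_series : sums_to_on_disk g0_coef g0.
Proof.
apply sums_to_on_disk_double_pole.
- intros [|n]; unfold g0_coef; rewrite Cmod_R.
  + rewrite Rabs_R0; simpl; lra.
  + pose proof (pos_INR n); rewrite S_INR; apply Rabs_le; lra.
- intros n; cbn -[INR]; rewrite !S_INR, <- !RtoC_minus; f_equal; field.
- intros z; unfold g0; cbn -[Cpow]; f_equal.
  rewrite <- !RtoC_minus.
  replace ((1 - 1) / 2 - 0 - 0) with 0 by field.
  replace ((1 - (1 + 1)) / 2 - (1 - 1) / 2 - ((1 - 1) / 2 - 0)) with (- (1 / 2)) by field.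
  rewrite RtoC_opp, RtoC_div by lra; field.
Qed.

Lemma h0_coef_1 : h0_coef 1%nat = RtoC 1.
Proof. unfold h0_coef; simpl; f_equal; field. Qed.

Definition f0 : harmonic :=
  Harmonic h0 g0 h0_coef g0_coef
    eq_refl h0_coef_1 eq_refl h0_series g0_series.

(* Main.v *)
Require Import Defs.
From Stdlib Require Import Reals Lra Lia.
From Coquelicot Require Import Coquelicot.

Open Scope R_scope.

(** Write [f = h + conj g] with dilatation [w = c z^n], [|c| = 1].  The real
    part of [f] is that of the analytic function [h + g], so [1 - 2 (h + g)] has
    positive real part on the disk, value 1 and derivative -2 at the origin.
    This is the equality case of Caratheodory's coefficient bound, which forces
    [1 - 2 (h + g) = (1 - z) / (1 + z)], that is [h + g = z / (1 + z)]
    ([caratheodory_extremal], [analytic_sum]).  Together with [g' = w h'] this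
    gives [h' = 1 / ((1 + z)^2 (1 + w))].

    The coefficients [(n + 1) / 2] and [(1 - n) / 2] of [f0] act on power series
    as the operators [h |-> (h + z h') / 2] and [g |-> (g - z g') / 2], so the
    two parts [H], [G] of the convolution have explicit derivatives.

    Sense-preservation is the inequality [|G'| < |H'|].  After removal of the
    common factor, for [n = 2] the dilatation of the convolution is [- w].  For
    [n = 1] it is, up to a unimodular constant, [z] times the quotient of the
    polynomial [2 + c z - c z^2] and its reciprocal polynomial, and the
    difference of the squared moduli of these two polynomials is explicit
    ([factor_lt_1], [factor_lt_2]).

    Univalence comes from shearing.  In the coordinate [zeta = z / (1 + z)],
    which runs over the half-plane [Re zeta < 1/2],
    [d(H - G)/dzeta = ((1 - w) / (1 + w) + (1 - 2 zeta)) / 2]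
    has real part at least [(1 - 2 Re zeta) / 2 > 0]
    ([convolution_derivative_gap]).  Hence the imaginary part of [H + conj G],
    which is that of [H - G], maps each vertical line of the half-plane
    increasingly onto the reals.  Each of its level sets is therefore a graph
    over the whole interval [Re zeta < 1/2], and along such a graph the real
    part of [H + conj G] increases because the Jacobian is positive
    ([harmonic_horizontal_increment], [level_increasing]).  So [H + conj G] is
    injective ([vertically_monotone_injective]). *)

(** * Complex derivatives *)

Notation cderive f z l := (@is_derive C_AbsRing C_NormedModule f z l).
Notation cpseries a z l := (@is_pseries C_AbsRing C_NormedModule a z l).

(** Linearity of the candidate differential is automatic, so only the first-order
    estimate remains to be checked. *)
Lemma cderive_iff (f : C -> C) (z l : C) :
  cderive f z l <->
  forall eps : R, 0 < eps -> exists d : R, 0 < d /\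
    forall w : C, Cmod (w - z) < d ->
      Cmod (f w - f z - (w - z) * l) <= eps * Cmod (w - z).
Proof.
split.
- intros [_ H] eps He.
  destruct (H z (fun P HP => HP) (mkposreal eps He)) as [d Hd].
  exists d; split; [apply cond_pos|].
  intros w Hw; exact (Hd w Hw).
- intros H; split.
  + apply (@is_linear_scal_l C_AbsRing C_NormedModule).
  + intros x Hx.
    rewrite <- (is_filter_lim_locally_unique _ _ Hx).
    intros eps; destruct (H eps (cond_pos eps)) as [d [Hd0 Hd]].
    exists (mkposreal d Hd0); intros w Hw; exact (Hd w Hw).
Qed.

Lemma cderive_const (c z : C) : cderive (fun _ => c) z (RtoC 0).
Proof. exact (@is_derive_const C_AbsRing C_NormedModule c z). Qed.

Lemma cderive_id (z : C) : cderive (fun w => w) z (RtoC 1).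
Proof.
apply cderive_iff; intros eps He; exists 1; split; [lra|]; intros w _.
replace (w - z - (w - z) * 1)%C with (RtoC 0) by ring.
rewrite Cmod_0; pose proof (Cmod_ge_0 (w - z)); nra.
Qed.

Lemma cderive_plus (f g : C -> C) (z a b : C) :
  cderive f z a -> cderive g z b ->
  cderive (fun w => f w + g w)%C z (a + b)%C.
Proof. apply (@is_derive_plus C_AbsRing C_NormedModule). Qed.

Lemma cderive_minus (f g : C -> C) (z a b : C) :
  cderive f z a -> cderive g z b ->
  cderive (fun w => f w - g w)%C z (a - b)%C.
Proof. apply (@is_derive_minus C_AbsRing C_NormedModule). Qed.

(** [C] carries two normed-module structures, with the same norm but
    different uniform structures; the product and chain rules are stated for the
    one that [C] has as a module over itself. *)
Lemma cderive_ring_iff (f : C -> C) (z l : C) :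
  cderive f z l <-> @is_derive C_AbsRing (AbsRing_NormedModule C_AbsRing) f z l.
Proof.
split; intros [_ H]; split; try exact H.
- apply (@is_linear_scal_l C_AbsRing (AbsRing_NormedModule C_AbsRing)).
- apply (@is_linear_scal_l C_AbsRing C_NormedModule).
Qed.

Lemma cderive_mult (f g : C -> C) (z a b : C) :
  cderive f z a -> cderive g z b ->
  cderive (fun w => f w * g w)%C z (a * g z + f z * b)%C.
Proof.
rewrite !cderive_ring_iff; intros Hf Hg.
apply (@is_derive_mult C_AbsRing f g z a b Hf Hg).
exact Cmult_comm.
Qed.

Lemma cderive_comp (f g : C -> C) (z a b : C) :
  cderive f (g z) a -> cderive g z b ->
  cderive (fun w => f (g w)) z (a * b)%C.
Proof.
intros Hf Hg; apply cderive_ring_iff in Hg.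
replace (a * b)%C with (@scal C_AbsRing C_NormedModule b a)
  by (change (b * a = a * b)%C; ring).
exact (@is_derive_comp C_AbsRing C_NormedModule f g z a b Hf Hg).
Qed.

Lemma cderive_Cinv (z : C) : z <> 0%C -> cderive Cinv z (- / (z * z))%C.
Proof.
intros Hz; apply cderive_iff; intros eps He.
pose proof (proj1 (Cmod_gt_0 z) Hz) as Hm.
set (m := Cmod z) in *.
exists (Rmin (m / 2) (eps * m ^ 3 / 2)); split.
{ assert (0 < m ^ 3) by (apply pow_lt; lra).
  apply Rmin_glb_lt; [lra|]; nra. }
intros w Hw.
assert (H1 : Cmod (w - z) < m / 2) by (eapply Rlt_le_trans; [exact Hw|apply Rmin_l]).
assert (H2 : Cmod (w - z) < eps * m ^ 3 / 2)
  by (eapply Rlt_le_trans; [exact Hw|apply Rmin_r]).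
assert (Hw2 : m / 2 < Cmod w).
{ pose proof (Cmod_triangle w (- (w - z))) as Ht.
  rewrite Cmod_opp in Ht; replace (w + - (w - z))%C with z in Ht by ring.
  fold m in Ht; lra. }
assert (Hw0 : w <> 0%C) by (apply Cmod_gt_0; lra).
replace (/ w - / z - (w - z) * - / (z * z))%C
  with ((w - z) * ((w - z) / (w * (z * z))))%C by (field; auto).
rewrite Cmod_mult, Rmult_comm.
apply Rmult_le_compat_r; [apply Cmod_ge_0|].
rewrite Cmod_div by (repeat apply Cmult_neq_0; auto).
rewrite !Cmod_mult; fold m.
assert (0 < m * m) by nra.
apply Rle_div_l; [nra|].
apply Rle_trans with (eps * (m / 2 * (m * m))).
- replace (eps * (m / 2 * (m * m))) with (eps * m ^ 3 / 2) by field; lra.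
- apply Rmult_le_compat_l; [lra|]. apply Rmult_le_compat_r; lra.
Qed.

Lemma cderive_div (f g : C -> C) (z a b : C) :
  cderive f z a -> cderive g z b -> g z <> 0%C ->
  cderive (fun w => f w / g w)%C z ((a * g z - f z * b) / (g z * g z))%C.
Proof.
intros Hf Hg H0.
pose proof (cderive_mult _ _ _ _ _ Hf (cderive_comp _ _ _ _ _ (cderive_Cinv _ H0) Hg)) as H.
eapply (eq_rect _ (fun l => cderive (fun w => f w / g w)%C z l)); [exact H|].
simpl; field; auto.
Qed.

Lemma cderive_ext_loc (f g : C -> C) (z l : C) (d : R) :
  0 < d -> (forall w, Cmod (w - z) < d -> f w = g w) ->
  cderive f z l -> cderive g z l.
Proof.
intros Hd H; apply is_derive_ext_loc.
exists (mkposreal d Hd); intros w Hw; apply H; exact Hw.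
Qed.

Lemma cderive_unique (f : C -> C) (z l l' : C) :
  cderive f z l -> cderive f z l' -> l = l'.
Proof.
intros H H'; rewrite <- (is_C_derive_unique _ _ _ H); now apply is_C_derive_unique.
Qed.

Lemma in_disk_open (z w : C) :
  in_disk z -> Cmod (w - z) < 1 - Cmod z -> in_disk w.
Proof.
unfold in_disk; intros Hz H.
pose proof (Cmod_triangle z (w - z)) as Ht.
replace (z + (w - z))%C with w in Ht by ring; lra.
Qed.
(** * Termwise differentiation of power series *)

Lemma subexponential_shift (a : nat -> C) :
  subexponential a -> subexponential (fun n => a (S n)).
Proof.
intros Ha r Hr; destruct (Ha r Hr) as [M HM].
exists (M / r); intros n.
refine (proj1 (Rle_div_r _ _ r _) _); [lra|].
replace (Cmod (a (S n)) * r ^ n * r) with (Cmod (a (S n)) * r ^ S n) by (simpl; ring).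
apply HM.
Qed.

Definition cseries_derive (a : nat -> C) (n : nat) : C := (RtoC (INR n + 1) * a (S n))%C.

Lemma subexponential_derive (a : nat -> C) :
  subexponential a -> subexponential (cseries_derive a).
Proof.
intros Ha; apply (subexponential_mult (fun n => RtoC (INR n + 1)));
  [|now apply subexponential_shift].
apply subexponential_linear; intros n; rewrite Cmod_R.
pose proof (pos_INR n); rewrite Rabs_pos_eq; lra.
Qed.

Lemma subexponential_abs_summable (a : nat -> C) (r : R) :
  subexponential a -> 0 < r < 1 -> ex_series (fun n => Cmod (a n) * r ^ n).
Proof.
intros Ha Hr; set (s := (1 + r) / 2).
assert (Hs : r < s < 1) by (unfold s; lra).
destruct (Ha s ltac:(lra)) as [M HM].
apply (@ex_series_le R_AbsRing R_CompleteNormedModule _ (fun n => M * (r / s) ^ n)).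
- intros n; change (Rabs (Cmod (a n) * r ^ n) <= M * (r / s) ^ n).
  pose proof (pow_lt r n ltac:(lra)); pose proof (pow_lt s n ltac:(lra)).
  pose proof (Cmod_ge_0 (a n)).
  rewrite Rabs_pos_eq by nra.
  unfold Rdiv; rewrite Rpow_mult_distr, pow_inv.
  replace (Cmod (a n) * r ^ n) with (Cmod (a n) * s ^ n * (r ^ n * / s ^ n)) by (field; lra).
  apply Rmult_le_compat_r; [|apply HM].
  apply Rmult_le_pos; [lra|]; left; now apply Rinv_0_lt_compat.
- apply (ex_series_scal (V := R_NormedModule) M), ex_series_geom.
  assert (0 <= r / s < 1).
  { split; [apply Rdiv_le_0_compat; lra|]. apply Rlt_div_l; lra. }
  rewrite Rabs_pos_eq; lra.
Qed.

Lemma Cmod_series_le (u : nat -> C) (v : nat -> R) (l : C) (L : R) :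
  @is_series C_AbsRing C_NormedModule u l ->
  @is_series R_AbsRing R_NormedModule v L ->
  (forall n, Cmod (u n) <= v n) -> Cmod l <= L.
Proof.
intros Hu Hv Huv.
assert (H1 : is_lim_seq (fun n => Cmod (sum_n (G := C_NormedModule) u n)) (Cmod l)).
{ exact (filterlim_comp _ _ _ _ _ _ _ _ Hu (@filterlim_norm C_AbsRing C_NormedModule l)). }
assert (H2 : is_lim_seq (sum_n v) L) by exact Hv.
refine (is_lim_seq_le _ _ (Cmod l) L _ H1 H2); intros n.
eapply Rle_trans; [apply (@norm_sum_n_m C_AbsRing C_NormedModule)|].
apply sum_n_m_le, Huv.
Qed.

(** Second-order Taylor bound for a power.  The factor [r] on the left replaces
    the exponent [n - 1] that would otherwise stand on the right. *)
Lemma power_taylor_bound (z w : C) (r : R) (n : nat) :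
  0 < r -> Cmod z <= r -> Cmod w <= r ->
  r * Cmod (w ^ S n - z ^ S n - (w - z) * (RtoC (INR n + 1) * z ^ n))
    <= (INR n + 1) ^ 2 * r ^ n * Cmod (w - z) ^ 2.
Proof.
intros Hr Hz Hw.
pose proof (Cmod_ge_0 (w - z)) as Hd.
induction n as [|n IH].
- simpl INR.
  replace (w ^ 1 - z ^ 1 - (w - z) * (RtoC (0 + 1) * z ^ 0))%C with (RtoC 0)
    by (rewrite Rplus_0_l; simpl; ring).
  rewrite Cmod_0; simpl; nra.
- set (D := (w ^ S n - z ^ S n - (w - z) * (RtoC (INR n + 1) * z ^ n))%C) in *.
  replace (w ^ S (S n) - z ^ S (S n) - (w - z) * (RtoC (INR (S n) + 1) * z ^ S n))%C
    with (w * D + (RtoC (INR n + 1) * z ^ n) * ((w - z) * (w - z)))%C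
    by (unfold D; rewrite S_INR, !RtoC_plus; simpl; ring).
  pose proof (pos_INR n) as Hn.
  assert (Hzn : Cmod (z ^ n) <= r ^ n)
    by (rewrite Cmod_pow; apply pow_incr; split; [apply Cmod_ge_0|exact Hz]).
  assert (H1 : Cmod (RtoC (INR n + 1) * z ^ n * ((w - z) * (w - z)))
               <= (INR n + 1) * r ^ n * Cmod (w - z) ^ 2).
  { rewrite !Cmod_mult, Cmod_R, Rabs_pos_eq by lra.
    replace (Cmod (w - z) ^ 2) with (Cmod (w - z) * Cmod (w - z)) by ring.
    apply Rmult_le_compat_r; [nra|]. apply Rmult_le_compat_l; lra. }
  assert (H2 : Cmod (w * D) <= r * Cmod D)
    by (rewrite Cmod_mult; apply Rmult_le_compat_r; [apply Cmod_ge_0|exact Hw]).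
  pose proof (Cmod_triangle (w * D) (RtoC (INR n + 1) * z ^ n * ((w - z) * (w - z)))) as H3.
  rewrite S_INR.
  set (X := r ^ n * Cmod (w - z) ^ 2).
  assert (HX : 0 <= X) by (apply Rmult_le_pos; [apply pow_le; lra|nra]).
  replace ((INR n + 1) * r ^ n * Cmod (w - z) ^ 2) with ((INR n + 1) * X) in H1
    by (unfold X; ring).
  replace ((INR n + 1) ^ 2 * r ^ n * Cmod (w - z) ^ 2) with ((INR n + 1) ^ 2 * X) in IH
    by (unfold X; ring).
  replace ((INR n + 1 + 1) ^ 2 * r ^ S n * Cmod (w - z) ^ 2)
    with (r * ((INR n + 1 + 1) ^ 2 * X)) by (unfold X; simpl; ring).
  apply Rmult_le_compat_l; [lra|].
  nra.
Qed.

Lemma is_cpseries_series (a : nat -> C) (z l : C) :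
  cpseries a z l <-> @is_series C_AbsRing C_NormedModule (fun n => a n * z ^ n)%C l.
Proof.
split; apply is_series_ext; intros n;
  [transitivity (@pow_n C_Ring z n * a n)%C; [reflexivity|]
  |symmetry; transitivity (@pow_n C_Ring z n * a n)%C; [reflexivity|]];
  rewrite (pow_n_Cpow z n); apply Cmult_comm.
Qed.

Lemma cseries_minus (u v : nat -> C) (l m : C) :
  @is_series C_AbsRing C_NormedModule u l -> @is_series C_AbsRing C_NormedModule v m ->
  @is_series C_AbsRing C_NormedModule (fun n => u n - v n)%C (l - m)%C.
Proof. apply (@is_series_minus C_AbsRing C_NormedModule). Qed.

Lemma cseries_scal (c : C) (u : nat -> C) (l : C) :
  @is_series C_AbsRing C_NormedModule u l ->
  @is_series C_AbsRing C_NormedModule (fun n => c * u n)%C (c * l)%C.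
Proof. apply (@is_series_scal C_AbsRing C_NormedModule). Qed.

Lemma cpseries_tail (a : nat -> C) (z l : C) :
  cpseries a z l ->
  @is_series C_AbsRing C_NormedModule (fun n => a (S n) * z ^ S n)%C (l - a 0%nat)%C.
Proof.
intros H; apply is_cpseries_series in H.
apply (@is_series_incr_1 C_AbsRing C_NormedModule (fun n => a n * z ^ n)%C).
replace (@plus C_NormedModule (l - a 0%nat)%C (a 0%nat * z ^ 0)%C) with l; [exact H|].
change (l = l - a 0%nat + a 0%nat * 1)%C; ring.
Qed.

(** Summing [power_taylor_bound] against the coefficients bounds the remainder
    [h w - h z - (w - z) h1 z] by a constant times [|w - z|^2]. *)
Lemma cseries_termwise_derive (a : nat -> C) (h h1 : C -> C) :
  sums_to_on_disk a h -> sums_to_on_disk (cseries_derive a) h1 ->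
  forall z, in_disk z -> cderive h z (h1 z).
Proof.
intros Hh Hh1 z Hz; apply cderive_iff; intros eps He.
assert (Hz' := Hz); unfold in_disk in Hz'; pose proof (Cmod_ge_0 z) as Hz0.
set (r := (1 + Cmod z) / 2).
assert (Hr : 0 < r < 1 /\ Cmod z < r) by (unfold r; lra).
pose proof (sums_to_on_disk_subexponential _ _ Hh) as Ha.
(* the weight [n + 1] of [cseries_derive] and a second one make up the square
   in [power_taylor_bound] *)
assert (Hb : ex_series (fun n => Cmod (RtoC (INR n + 1) * cseries_derive a n) * r ^ n)).
{ apply subexponential_abs_summable; [|lra].
  apply (subexponential_mult (fun n => RtoC (INR n + 1))); [|now apply subexponential_derive].
  apply subexponential_linear; intros n; rewrite Cmod_R.
  pose proof (pos_INR n); rewrite Rabs_pos_eq; lra. }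
destruct Hb as [M HM].
assert (HM0 : 0 <= M).
{ refine (Rle_trans _ _ _ (Cmod_ge_0 0) (Cmod_series_le (fun _ => RtoC 0) _ _ _ _ HM _)).
  - apply (filterlim_ext (fun _ : nat => RtoC 0)); [|apply filterlim_const].
    induction x as [|n IH]; [now rewrite sum_O|].
    rewrite sum_Sn, <- IH; change (RtoC 0 = 0 + 0)%C; ring.
  - intros n; rewrite Cmod_0.
    apply Rmult_le_pos; [apply Cmod_ge_0|apply pow_le; lra]. }
exists (Rmin (r - Cmod z) (eps * r / (M + 1))); split.
{ apply Rmin_glb_lt; [lra|]. apply Rdiv_lt_0_compat; [nra|lra]. }
intros w Hw.
assert (H1 := Rlt_le_trans _ _ _ Hw (Rmin_l _ _)).
assert (H2 := Rlt_le_trans _ _ _ Hw (Rmin_r _ _)).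
assert (Hwr : Cmod w < r).
{ pose proof (Cmod_triangle z (w - z)) as Ht.
  replace (z + (w - z))%C with w in Ht by ring; lra. }
assert (Hwd : in_disk w) by (unfold in_disk; lra).
pose proof (cseries_minus _ _ _ _
  (cseries_minus _ _ _ _ (cpseries_tail _ _ _ (Hh w Hwd)) (cpseries_tail _ _ _ (Hh z Hz)))
  (cseries_scal (w - z) _ _ (proj1 (is_cpseries_series _ _ _) (Hh1 z Hz)))) as HS.
replace (h w - a 0%nat - (h z - a 0%nat) - (w - z) * h1 z)%C
  with (h w - h z - (w - z) * h1 z)%C in HS by ring.
set (E := (h w - h z - (w - z) * h1 z)%C) in *.
set (d := Cmod (w - z)) in *.
assert (HE : r * Cmod E <= d ^ 2 * M).
{ replace (r * Cmod E) with (Cmod (RtoC r * E))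
    by (rewrite Cmod_mult, Cmod_R, Rabs_pos_eq; lra).
  refine (Cmod_series_le _ _ _ _ (cseries_scal (RtoC r) _ _ HS)
    (@is_series_scal R_AbsRing R_NormedModule (d ^ 2) _ _ HM) _).
  intros n.
  change (Cmod (r * (a (S n) * w ^ S n - a (S n) * z ^ S n
            - (w - z) * (cseries_derive a n * z ^ n)))
          <= d ^ 2 * (Cmod (RtoC (INR n + 1) * cseries_derive a n) * r ^ n)).
  unfold cseries_derive.
  replace (RtoC r * (a (S n) * w ^ S n - a (S n) * z ^ S n
            - (w - z) * (RtoC (INR n + 1) * a (S n) * z ^ n)))%C
    with (a (S n) * (RtoC r * (w ^ S n - z ^ S n - (w - z) * (RtoC (INR n + 1) * z ^ n))))%C
    by ring.
  rewrite !Cmod_mult, !Cmod_R, (Rabs_pos_eq r) by lra.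
  pose proof (pos_INR n); rewrite (Rabs_pos_eq (INR n + 1)) by lra.
  pose proof (power_taylor_bound z w r n ltac:(lra) ltac:(lra) ltac:(lra)) as Hb.
  fold d in Hb.
  replace (d ^ 2 * ((INR n + 1) * ((INR n + 1) * Cmod (a (S n))) * r ^ n))
    with (Cmod (a (S n)) * ((INR n + 1) ^ 2 * r ^ n * d ^ 2)) by ring.
  apply Rmult_le_compat_l; [apply Cmod_ge_0|exact Hb]. }
assert (Hd0 : 0 <= d) by apply Cmod_ge_0.
apply Rmult_le_reg_l with r; [lra|].
apply Rlt_div_r in H2; [|lra].
nra.
Qed.

Lemma cseries_derive_sum (a : nat -> C) (h : C -> C) :
  sums_to_on_disk a h -> sums_to_on_disk (cseries_derive a) (C_derive h).
Proof.
intros Hh.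
assert (H1 : sums_to_on_disk (cseries_derive a) (C_PSeries (cseries_derive a))).
{ intros z Hz; apply C_PSeries_correct, subexponential_ex_pseries; [|exact Hz].
  apply subexponential_derive; eapply sums_to_on_disk_subexponential; exact Hh. }
intros z Hz.
rewrite (is_C_derive_unique _ _ _ (cseries_termwise_derive _ _ _ Hh H1 z Hz)).
now apply H1.
Qed.

Lemma sums_to_on_disk_cderive (a : nat -> C) (h : C -> C) :
  sums_to_on_disk a h -> forall z, in_disk z -> cderive h z (C_derive h z).
Proof.
intros Hh; apply (cseries_termwise_derive a); [exact Hh|now apply cseries_derive_sum].
Qed.
(** * Means over roots of unity *)

Lemma expi_mult (s t : R) : (expi s * expi t)%C = expi (s + t).
Proof.
unfold expi, Cmult; simpl; rewrite cos_plus, sin_plus; f_equal; ring.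
Qed.

Lemma expi_pow (t : R) (n : nat) : (expi t ^ n)%C = expi (INR n * t).
Proof.
induction n as [|n IH].
- simpl; rewrite Rmult_0_l; unfold expi; rewrite cos_0, sin_0; reflexivity.
- change (expi t ^ S n)%C with (expi t * expi t ^ n)%C.
  rewrite IH, expi_mult, S_INR; f_equal; ring.
Qed.

Lemma Cmod_expi (t : R) : Cmod (expi t) = 1.
Proof.
unfold Cmod, expi; simpl fst; simpl snd.
rewrite <- sqrt_1; f_equal; rewrite <- (sin2_cos2 t); unfold Rsqr; ring.
Qed.

Lemma expi_neq_1 (t : R) : 0 < t < 2 * PI -> expi t <> RtoC 1.
Proof.
intros Ht H; apply (f_equal fst) in H; simpl in H.
replace t with (2 * (t / 2)) in H by field.
rewrite cos_2a_sin in H.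
assert (0 < sin (t / 2)) by (apply sin_gt_0; lra).
nra.
Qed.

Lemma expi_2PI : expi (2 * PI) = RtoC 1.
Proof. unfold expi; rewrite cos_2PI, sin_2PI; reflexivity. Qed.

Lemma unit_conj (e : C) : Cmod e = 1 -> (e * Cconj e)%C = RtoC 1.
Proof. intros He; rewrite <- Cmod2_conj, He; f_equal; ring. Qed.

(** A mean over the [N + 1]-st roots of unity stands for an integral over the
    unit circle: on trigonometric polynomials of degree at most [N] both agree. *)
Definition root_mean (N : nat) (F : C -> C) : C :=
  (sum_n (G := C_AbelianMonoid) (fun k => F (expi (2 * PI / INR (S N)) ^ k)%C) N / INR (S N))%C.

Lemma RtoC_INR_S_neq_0 (N : nat) : RtoC (INR (S N)) <> 0%C.
Proof. intros H; apply (f_equal fst) in H; revert H; apply (not_0_INR (S N)); lia. Qed.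

Lemma root_mean_ext (N : nat) (F G : C -> C) :
  (forall e, Cmod e = 1 -> F e = G e) -> root_mean N F = root_mean N G.
Proof.
intros H; unfold root_mean; f_equal; apply sum_n_ext; intros k; apply H.
rewrite Cmod_pow, Cmod_expi; apply pow1.
Qed.

Lemma root_mean_plus (N : nat) (F G : C -> C) :
  root_mean N (fun e => F e + G e)%C = (root_mean N F + root_mean N G)%C.
Proof.
unfold root_mean.
pose proof (sum_n_plus (G := C_AbelianMonoid) (fun k => F (expi (2 * PI / INR (S N)) ^ k)%C)
  (fun k => G (expi (2 * PI / INR (S N)) ^ k)%C) N) as H.
unfold Cdiv; rewrite <- Cmult_plus_distr_r; f_equal; exact H.
Qed.

Lemma root_mean_scal (N : nat) (c : C) (F : C -> C) :
  root_mean N (fun e => c * F e)%C = (c * root_mean N F)%C.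
Proof.
unfold root_mean.
pose proof (sum_n_mult_l (K := C_Ring) c (fun k => F (expi (2 * PI / INR (S N)) ^ k)%C) N) as H.
unfold Cdiv; rewrite Cmult_assoc; f_equal; exact H.
Qed.

Lemma root_mean_sum (N M : nat) (F : nat -> C -> C) :
  root_mean N (fun e => sum_n (G := C_AbelianMonoid) (fun m => F m e) M)
  = sum_n (G := C_AbelianMonoid) (fun m => root_mean N (F m)) M.
Proof.
induction M as [|M IH].
- rewrite sum_O; apply root_mean_ext; intros e _; now rewrite sum_O.
- rewrite sum_Sn, <- IH; change (@plus C_AbelianMonoid) with Cplus.
  rewrite <- root_mean_plus; apply root_mean_ext; intros e _.
  now rewrite sum_Sn.
Qed.

Lemma Re_sum_n (u : nat -> C) (n : nat) :
  Re (sum_n (G := C_AbelianMonoid) u n) = sum_n (fun k => Re (u k)) n.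
Proof.
induction n as [|n IH]; [now rewrite !sum_O|].
rewrite !sum_Sn, <- IH; reflexivity.
Qed.

Lemma root_mean_le (N : nat) (F G : C -> C) :
  (forall e, Cmod e = 1 -> Cmod (F e) <= Re (G e)) ->
  Cmod (root_mean N F) <= Re (root_mean N G).
Proof.
intros H; unfold root_mean.
rewrite Cmod_div by apply RtoC_INR_S_neq_0.
assert (HN : 0 < INR (S N)) by (apply lt_0_INR; lia).
unfold Cdiv; rewrite <- RtoC_inv, re_scal_r by lra.
rewrite Cmod_R, Rabs_pos_eq by lra.
apply Rmult_le_compat_r; [left; now apply Rinv_0_lt_compat|].
eapply Rle_trans; [apply (@norm_sum_n_m C_AbsRing C_NormedModule)|].
rewrite Re_sum_n; apply sum_n_m_le; intros k; apply H.
rewrite Cmod_pow, Cmod_expi; apply pow1.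
Qed.

Lemma root_mean_conj (N : nat) (F : C -> C) :
  root_mean N (fun e => Cconj (F e)) = Cconj (root_mean N F).
Proof.
unfold root_mean; rewrite Cdiv_conj by apply RtoC_INR_S_neq_0.
f_equal.
- generalize N at 2 4; intros n.
  induction n as [|n IH]; [now rewrite !sum_O|].
  rewrite !sum_Sn, IH; symmetry; apply Cplus_conj.
- unfold Cconj; simpl; unfold RtoC; f_equal; lra.
Qed.

Lemma geometric_sum (x : C) (N : nat) :
  ((1 - x) * sum_n (G := C_AbelianMonoid) (fun k => x ^ k) N = 1 - x ^ S N)%C.
Proof.
induction N as [|N IH]; [rewrite sum_O; simpl; ring|].
rewrite sum_Sn; change (@plus C_AbelianMonoid) with Cplus.
rewrite Cmult_plus_distr_l, IH; simpl; ring.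
Qed.

Lemma root_mean_pow (N m : nat) :
  (0 < m <= N)%nat -> root_mean N (fun e => e ^ m)%C = RtoC 0.
Proof.
intros Hm; unfold root_mean.
set (x := expi (INR m * (2 * PI / INR (S N)))).
assert (HN : 0 < INR (S N)) by (apply lt_0_INR; lia).
assert (Hx : x <> RtoC 1).
{ apply expi_neq_1; pose proof PI_RGT_0.
  assert (0 < INR m) by (apply lt_0_INR; lia).
  assert (INR m < INR (S N)) by (apply lt_INR; lia).
  replace (INR m * (2 * PI / INR (S N))) with (INR m / INR (S N) * (2 * PI)) by (field; lra).
  split; [apply Rmult_lt_0_compat; [apply Rdiv_lt_0_compat; lra|lra]|].
  rewrite <- (Rmult_1_l (2 * PI)) at 2; apply Rmult_lt_compat_r; [lra|].
  apply (proj2 (Rlt_div_l _ _ _ HN)); lra. }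
assert (HxN : (x ^ S N)%C = RtoC 1).
{ unfold x; rewrite expi_pow.
  replace (INR (S N) * (INR m * (2 * PI / INR (S N)))) with (INR m * (2 * PI)) by (field; lra).
  rewrite <- expi_pow, expi_2PI; clear; induction m as [|m IH]; [reflexivity|].
  simpl; rewrite IH; ring. }
rewrite (sum_n_ext (G := C_AbelianMonoid) _ (fun k => x ^ k)%C).
- pose proof (geometric_sum x N) as H; rewrite HxN in H.
  replace (1 - 1)%C with (RtoC 0) in H by ring.
  assert (H1 : (1 - x)%C <> 0%C).
  { intros H0; apply Hx; replace x with (1 - (1 - x))%C by ring; rewrite H0; ring. }
  set (s := sum_n _ _) in *.
  replace s with (/ (1 - x) * ((1 - x) * s))%C by (field; exact H1).
  rewrite H; unfold Cdiv; ring.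
- intros k; unfold x; rewrite !expi_pow; f_equal; ring.
Qed.

Lemma root_mean_const (N : nat) (c : C) : root_mean N (fun _ => c) = c.
Proof.
unfold root_mean.
replace (sum_n (G := C_AbelianMonoid) (fun _ => c) N) with (INR (S N) * c)%C.
- field; apply RtoC_INR_S_neq_0.
- generalize N; intros n; induction n as [|n IH].
  + rewrite sum_O; simpl; ring.
  + rewrite sum_Sn, <- IH, (S_INR (S n)), RtoC_plus.
    change (@plus C_AbelianMonoid) with Cplus; ring.
Qed.

(** Conjugation inverts points of the circle, so the integrand is a power of [e]
    or of its conjugate with exponent at most [N]. *)
Lemma root_mean_orthogonal (N m n : nat) :
  (m <= N)%nat -> (n <= N)%nat ->
  root_mean N (fun e => e ^ m * Cconj e ^ n)%C = RtoC (if Nat.eqb m n then 1 else 0).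
Proof.
intros Hm Hn.
assert (Hred : forall e k, Cmod e = 1 -> (e ^ k * Cconj e ^ k)%C = RtoC 1).
{ intros e k He; rewrite <- Cpow_mult_l, (unit_conj _ He), Cpow_1_l; reflexivity. }
destruct (PeanoNat.Nat.eqb_spec m n) as [->|Hmn].
- rewrite <- (root_mean_const N 1); apply root_mean_ext; intros e He; now apply Hred.
- destruct (PeanoNat.Nat.le_gt_cases n m) as [Hle|Hgt].
  + replace m with ((m - n) + n)%nat by lia.
    rewrite <- (root_mean_pow N (m - n)) by lia.
    apply root_mean_ext; intros e He.
    rewrite Cpow_add_r, <- Cmult_assoc, Hred by exact He; ring.
  + replace n with (m + (n - m))%nat by lia.
    transitivity (Cconj (RtoC 0)); [|unfold Cconj; simpl; unfold RtoC; f_equal; ring].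
    rewrite <- (root_mean_pow N (n - m)), <- root_mean_conj by lia.
    apply root_mean_ext; intros e He.
    rewrite Cpow_add_r, Cmult_assoc, Hred, Cpow_conj by exact He; ring.
Qed.
Definition cpartial (a : nat -> C) (M : nat) (z : C) : C :=
  sum_n (G := C_AbelianMonoid) (fun m => a m * z ^ m)%C M.

(** * The equality case of Caratheodory's coefficient bound *)

(** The carrier of an abelian monoid built on [C] is not recognised as [C] by the
    ring tactic. *)
Ltac eq_in_C := match goal with |- ?x = ?y => change (@eq C x y) end.

Lemma sum_n_single (c : nat -> C) (n M : nat) :
  sum_n (G := C_AbelianMonoid) (fun m => c m * RtoC (if Nat.eqb m n then 1 else 0))%C M
  = if Nat.leb n M then c n else RtoC 0.
Proof.
induction M as [|M IH].
- rewrite sum_O; destruct n; simpl; eq_in_C; ring.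
- rewrite sum_Sn, IH; change (@plus C_AbelianMonoid) with Cplus.
  destruct (PeanoNat.Nat.eqb_spec (S M) n) as [<-|Hne].
  + rewrite PeanoNat.Nat.leb_refl; rewrite (proj2 (PeanoNat.Nat.leb_gt (S M) M)) by lia; eq_in_C; ring.
  + destruct (PeanoNat.Nat.leb_spec n M); destruct (PeanoNat.Nat.leb_spec n (S M));
      try lia; eq_in_C; ring.
Qed.

Lemma Cconj_RtoC (x : R) : Cconj (RtoC x) = RtoC x.
Proof. unfold Cconj; simpl; unfold RtoC; f_equal; ring. Qed.

Lemma root_mean_partial (a : nat -> C) (r : R) (N M n : nat) :
  (n <= M)%nat -> (M <= N)%nat ->
  root_mean N (fun e => cpartial a M (r * e) * Cconj e ^ n)%C = (a n * r ^ n)%C.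
Proof.
intros HnM HMN.
transitivity (root_mean N (fun e => sum_n (G := C_AbelianMonoid)
   (fun m => (a m * r ^ m) * (e ^ m * Cconj e ^ n))%C M)).
- apply root_mean_ext; intros e _; unfold cpartial.
  etransitivity; [symmetry; apply (sum_n_mult_r (K := C_Ring))|].
  apply sum_n_ext; intros m; change (@mult C_Ring) with Cmult.
  eq_in_C; rewrite Cpow_mult_l; ring.
- rewrite root_mean_sum.
  transitivity (sum_n (G := C_AbelianMonoid)
    (fun m => (a m * r ^ m) * RtoC (if Nat.eqb m n then 1 else 0))%C M).
  + apply sum_n_ext_loc; intros m Hm.
    rewrite root_mean_scal, root_mean_orthogonal by lia; reflexivity.
  + rewrite sum_n_single, (proj2 (PeanoNat.Nat.leb_le n M)) by lia; reflexivity.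
Qed.

(** The conjugate series has only non-positive frequencies, so its product with
    [Cconj e ^ n] has a mean only through the constant term, when [n = 0]. *)
Lemma root_mean_conj_partial (a : nat -> C) (r : R) (N M n : nat) :
  (M + n <= N)%nat ->
  root_mean N (fun e => Cconj (cpartial a M (r * e)) * Cconj e ^ n)%C
  = (Cconj (a 0%nat) * RtoC (if Nat.eqb n 0 then 1 else 0))%C.
Proof.
intros HN.
transitivity (root_mean N (fun e => Cconj (sum_n (G := C_AbelianMonoid)
   (fun m => (a m * r ^ m) * (e ^ (m + n) * Cconj e ^ 0))%C M))).
- apply root_mean_ext; intros e _; unfold cpartial.
  rewrite <- Cpow_conj, <- Cmult_conj; f_equal.
  etransitivity; [symmetry; apply (sum_n_mult_r (K := C_Ring))|].
  apply sum_n_ext; intros m; change (@mult C_Ring) with Cmult.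
  eq_in_C; rewrite Cpow_mult_l, Cpow_add_r; simpl; ring.
- rewrite root_mean_conj, root_mean_sum.
  destruct n as [|n].
  + rewrite PeanoNat.Nat.eqb_refl, Cmult_1_r; f_equal.
    transitivity (sum_n (G := C_AbelianMonoid)
      (fun m => (a m * r ^ m) * RtoC (if Nat.eqb m 0 then 1 else 0))%C M).
    * apply sum_n_ext_loc; intros m Hm.
      rewrite root_mean_scal, root_mean_orthogonal, PeanoNat.Nat.add_0_r by lia; reflexivity.
    * rewrite sum_n_single; simpl; ring.
  + simpl Nat.eqb; rewrite Cmult_0_r, <- (Cconj_RtoC 0); f_equal.
    transitivity (sum_n (G := C_AbelianMonoid)
      (fun m => (a m * r ^ m) * RtoC (if Nat.eqb m (S M) then 1 else 0))%C M).
    * apply sum_n_ext_loc; intros m Hm.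
      rewrite root_mean_scal, root_mean_orthogonal by lia.
      rewrite (proj2 (PeanoNat.Nat.eqb_neq (m + S n) 0)) by lia.
      rewrite (proj2 (PeanoNat.Nat.eqb_neq m (S M))) by lia; reflexivity.
    * rewrite sum_n_single, (proj2 (PeanoNat.Nat.leb_gt (S M) M)) by lia; reflexivity.
Qed.

(** Polynomial approximation on a smaller disk reduces positivity of [Re q] to
    finite sums. *)
Lemma cpartial_uniform (a : nat -> C) (q : C -> C) (r eps : R) (n : nat) :
  sums_to_on_disk a q -> 0 < r < 1 -> 0 < eps ->
  exists M, (n <= M)%nat /\
    forall z, Cmod z <= r -> Cmod (q z - cpartial a M z) <= eps.
Proof.
intros Hq Hr He.
destruct (subexponential_abs_summable a r (sums_to_on_disk_subexponential _ _ Hq) Hr)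
  as [L HL].
assert (HL' : is_lim_seq (sum_n (fun m => Cmod (a m) * r ^ m)) L) by exact HL.
apply is_lim_seq_spec in HL'.
destruct (HL' (mkposreal eps He)) as [N HN]; simpl in HN.
exists (N + n)%nat; split; [lia|]; intros z Hz.
set (M := (N + n)%nat).
assert (HM : L - sum_n (fun m => Cmod (a m) * r ^ m) M <= eps).
{ specialize (HN M ltac:(unfold M; lia)).
  apply Rabs_def2 in HN; lra. }
eapply Rle_trans; [|exact HM].
assert (Hzd : in_disk z) by (unfold in_disk; lra).
pose proof (proj1 (is_cpseries_series _ _ _) (Hq z Hzd)) as Hs.
refine (Cmod_series_le (fun k => a (S M + k)%nat * z ^ (S M + k))%C
  (fun k => Cmod (a (S M + k)%nat) * r ^ (S M + k)) _ _ _ _ _).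
- apply (is_series_incr_n (V := C_NormedModule) (fun m => a m * z ^ m)%C); [lia|].
  match goal with |- is_series _ ?l => replace l with (q z); [exact Hs|] end.
  change (q z = q z - cpartial a M z + cpartial a M z)%C; ring.
- apply (is_series_incr_n (V := R_NormedModule) (fun m => Cmod (a m) * r ^ m)); [lia|].
  match goal with |- is_series _ ?l => replace l with L; [exact HL|] end.
  change (L = (L - sum_n (fun m => Cmod (a m) * r ^ m) M)
    + sum_n (fun m => Cmod (a m) * r ^ m) M); lra.
- intros k; rewrite Cmod_mult, Cmod_pow.
  apply Rmult_le_compat_l; [apply Cmod_ge_0|].
  apply pow_incr; split; [apply Cmod_ge_0|exact Hz].
Qed.

Lemma Re_plus_conj (c : C) : (c + Cconj c)%C = RtoC (2 * Re c).
Proof. unfold Cconj, Cplus, RtoC; simpl; f_equal; unfold Re; ring. Qed.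

Lemma le_of_le_plus_eps (x y k : R) :
  0 < k -> (forall eps, 0 < eps -> x <= y + k * eps) -> x <= y.
Proof.
intros Hk H; apply Rnot_lt_le; intros Hlt.
specialize (H ((x - y) / (2 * k)) ltac:(apply Rdiv_lt_0_compat; lra)).
replace (k * ((x - y) / (2 * k))) with ((x - y) / 2) in H by (field; lra); lra.
Qed.

Section Caratheodory.

Variables (a : nat -> C) (q : C -> C).
Hypothesis Hq : sums_to_on_disk a q.
Hypothesis Hpos : forall z, in_disk z -> 0 <= Re (q z).
Hypothesis Ha0 : a 0%nat = RtoC 1.
Hypothesis Ha1 : a 1%nat = RtoC (-2).

(** The mean of [2 Re (q (r e)) * Cconj e ^ n] over the unit circle; the extra
    term for [n = 0] is the conjugate of the constant coefficient 1. *)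
Definition circle_moment (r : R) (n : nat) : C :=
  (a n * r ^ n + RtoC (if Nat.eqb n 0 then 1 else 0))%C.

(** The weight [2 + e + conj e = 2 (1 + Re e)] is nonnegative on the circle, so the
    [n + 1]-st moment of the positive function [2 Re q] against it is at most the
    0-th one, which equals [4 - 4 r] since the first coefficient is -2. *)
Lemma caratheodory_moment_bound (r : R) (n : nat) :
  0 < r < 1 ->
  Cmod (2 * circle_moment r (S n) + circle_moment r n + circle_moment r (S (S n)))
    <= 4 * (1 - r).
Proof.
intros Hr; apply (le_of_le_plus_eps _ _ 8); [lra|]; intros eps He.
destruct (cpartial_uniform a q r eps (S (S n)) Hq Hr He) as [M [HnM HM]].
set (N := (M + S (S n))%nat).
set (P := fun e : C => (cpartial a M (r * e) + Cconj (cpartial a M (r * e)))%C).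
assert (Hmom : forall k, (k <= S (S n))%nat ->
  root_mean N (fun e => P e * Cconj e ^ k)%C = circle_moment r k).
{ intros k Hk; unfold circle_moment.
  rewrite <- (root_mean_partial a r N M k) by lia.
  replace (RtoC (if Nat.eqb k 0 then 1 else 0))
    with (Cconj (a 0%nat) * RtoC (if Nat.eqb k 0 then 1 else 0))%C
    by (rewrite Ha0, Cconj_RtoC; ring).
  rewrite <- (root_mean_conj_partial a r N M k) by lia.
  rewrite <- root_mean_plus; apply root_mean_ext; intros e _; unfold P; ring. }
assert (Hlow : forall e, Cmod e = 1 -> - eps <= Re (cpartial a M (r * e))).
{ intros e He1.
  assert (Hz : Cmod (r * e) = r) by (rewrite Cmod_mult, He1, Cmod_R, Rabs_pos_eq; lra).
  pose proof (HM (r * e)%C ltac:(lra)) as H1.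
  pose proof (Hpos (r * e)%C ltac:(unfold in_disk; lra)) as H2.
  pose proof (re_le_Cmod (q (r * e) - cpartial a M (r * e))%C) as H3.
  unfold Cminus in H3; rewrite re_plus, re_opp in H3.
  fold (q (r * e) - cpartial a M (r * e))%C in H3.
  apply Rabs_le_between in H3; lra. }
assert (HF : root_mean N (fun e => P e * (2 + (e + Cconj e)) * Cconj e ^ S n)%C
  = (2 * circle_moment r (S n) + circle_moment r n + circle_moment r (S (S n)))%C).
{ rewrite <- !Hmom by lia.
  rewrite <- root_mean_scal, <- !root_mean_plus.
  apply root_mean_ext; intros e He1.
  pose proof (unit_conj e He1) as Hu.
  replace (P e * Cconj e ^ n)%C with (P e * Cconj e ^ n * (e * Cconj e))%C
    by (rewrite Hu; ring).
  simpl; ring. }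
(* [4 eps] compensates the possible negativity of the partial sum; and since
   the first factor of the integrand is real, [2 Cconj e] has the same effect on
   the real part as [e + Cconj e] *)
assert (HG : root_mean N (fun e => (P e + RtoC (4 * eps)) * (2 + 2 * Cconj e))%C
  = (2 * circle_moment r 0 + 2 * circle_moment r 1 + RtoC (8 * eps))%C).
{ rewrite <- !Hmom by lia.
  rewrite <- !root_mean_scal, <- (root_mean_const N (RtoC (8 * eps))), <- !root_mean_plus.
  transitivity (root_mean N (fun e => (2 * (P e * Cconj e ^ 0) + 2 * (P e * Cconj e ^ 1)
    + RtoC (8 * eps)) + RtoC (8 * eps) * (e ^ 0 * Cconj e ^ 1))%C).
  - apply root_mean_ext; intros e _; rewrite !RtoC_mult; simpl; ring.
  - rewrite root_mean_plus, (root_mean_scal N (RtoC (8 * eps))), root_mean_orthogonal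
      by (unfold N; lia).
    simpl Nat.eqb; cbv iota; rewrite Cmult_0_r, Cplus_0_r; reflexivity. }
rewrite <- HF.
eapply Rle_trans; [apply root_mean_le with
  (G := (fun e => (P e + RtoC (4 * eps)) * (2 + 2 * Cconj e))%C)|].
- intros e He1; unfold P; rewrite !Re_plus_conj.
  rewrite !Cmod_mult, Cmod_pow, Cmod_conj, He1, pow1, Rmult_1_r.
  rewrite <- !RtoC_plus, !Cmod_R.
  set (x := Re (cpartial a M (r * e))).
  pose proof (Hlow e He1) as Hx; fold x in Hx.
  rewrite re_scal_l, re_plus, re_scal_l, re_conj, re_RtoC.
  pose proof (re_le_Cmod e) as Hre; rewrite He1 in Hre; apply Rabs_le_between in Hre.
  rewrite (Rabs_pos_eq (2 + _)) by lra.
  replace (2 + 2 * Re e) with (2 * (1 + Re e)) by ring.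
  apply Rmult_le_compat_r; [lra|].
  apply Rabs_le; lra.
- rewrite HG; unfold circle_moment; rewrite Ha0, Ha1.
  simpl Nat.eqb; simpl Cpow.
  apply Req_le.
  unfold Re, Cplus, Cmult, RtoC; simpl; ring.
Qed.

Lemma pow_ge_bernoulli (r : R) (j : nat) : 0 < r < 1 -> 0 <= 1 - r ^ j <= INR j * (1 - r).
Proof.
intros Hr; induction j as [|j IH]; [simpl; lra|].
pose proof (pow_lt r j ltac:(lra)).
rewrite S_INR; simpl; split; nra.
Qed.

Lemma circle_moment_1_dist (r : R) (n : nat) : 0 < r < 1 ->
  Cmod (circle_moment 1 n - circle_moment r n) <= Cmod (a n) * INR n * (1 - r).
Proof.
intros Hr; unfold circle_moment.
match goal with |- Cmod ?x <= _ => replace x with (a n * RtoC (1 - r ^ n))%C end.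
- rewrite Cmod_mult, Cmod_R, Rmult_assoc.
  pose proof (pow_ge_bernoulli r n Hr).
  apply Rmult_le_compat_l; [apply Cmod_ge_0|]. rewrite Rabs_pos_eq; lra.
- rewrite Cpow_1_l, RtoC_minus, RtoC_pow; ring.
Qed.

(** Let [r] tend to 1 in [caratheodory_moment_bound]: the bound tends to 0, and the
    moments differ from their values at 1 by at most a multiple of [1 - r]. *)
Lemma caratheodory_recurrence (n : nat) :
  (2 * circle_moment 1 (S n) + circle_moment 1 n + circle_moment 1 (S (S n)) = 0)%C.
Proof.
set (D := fun r : R =>
  (2 * circle_moment r (S n) + circle_moment r n + circle_moment r (S (S n)))%C).
set (K := 4 + 2 * (Cmod (a (S n)) * INR (S n)) + Cmod (a n) * INR n
          + Cmod (a (S (S n))) * INR (S (S n))).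
assert (HD : forall r, 0 < r < 1 -> Cmod (D 1) <= K * (1 - r)).
{ intros r Hr.
  pose proof (caratheodory_moment_bound r n Hr) as H0; fold (D r) in H0.
  pose proof (circle_moment_1_dist r (S n) Hr) as H1.
  pose proof (circle_moment_1_dist r n Hr) as H2.
  pose proof (circle_moment_1_dist r (S (S n)) Hr) as H3.
  replace (D 1) with (D r + (2 * (circle_moment 1 (S n) - circle_moment r (S n))
    + ((circle_moment 1 n - circle_moment r n)
    + (circle_moment 1 (S (S n)) - circle_moment r (S (S n))))))%C by (unfold D; ring).
  eapply Rle_trans; [apply Cmod_triangle|].
  eapply Rle_trans; [apply Rplus_le_compat; [exact H0|apply Cmod_triangle]|].
  eapply Rle_trans; [apply Rplus_le_compat_l, Rplus_le_compat;
    [rewrite Cmod_mult, Cmod_R, Rabs_pos_eq by lra; apply Rle_refl|apply Cmod_triangle]|].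
  unfold K; lra. }
apply Cmod_eq_0; fold (D 1).
apply Rle_antisym; [|apply Cmod_ge_0].
assert (HK : 0 < K).
{ unfold K. pose proof (Cmod_ge_0 (a n)); pose proof (Cmod_ge_0 (a (S n)));
  pose proof (Cmod_ge_0 (a (S (S n)))).
  pose proof (pos_INR n); pose proof (pos_INR (S n)); pose proof (pos_INR (S (S n))).
  nra. }
apply Rnot_lt_le; intros Hlt.
set (t := Rmin (1 / 2) (Cmod (D 1) / (2 * K))).
assert (Ht : 0 < t) by (apply Rmin_glb_lt; [lra|apply Rdiv_lt_0_compat; lra]).
assert (Ht1 : t <= 1 / 2) by apply Rmin_l.
assert (Ht2 : t <= Cmod (D 1) / (2 * K)) by apply Rmin_r.
specialize (HD (1 - t) ltac:(lra)).
replace (1 - (1 - t)) with t in HD by ring.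
assert (K * t <= K * (Cmod (D 1) / (2 * K))) by (apply Rmult_le_compat_l; lra).
replace (K * (Cmod (D 1) / (2 * K))) with (Cmod (D 1) / 2) in H by (field; lra).
lra.
Qed.

(** Coefficients of [(1 + z) q z]. *)
Definition sum_consecutive (n : nat) : C :=
  match n with O => a 0%nat | S m => (a n + a m)%C end.

Lemma sum_consecutive_vanish (n : nat) : sum_consecutive (S (S n)) = RtoC 0.
Proof.
induction n as [|n IH].
- pose proof (caratheodory_recurrence 0) as H; unfold circle_moment in H; simpl in H.
  simpl; rewrite Ha0, Ha1 in *.
  replace (a 2%nat + RtoC (-2))%C with ((2 * (RtoC (-2) * (1 * 1) + 0) + (1 * 1 + 1)
    + (a 2%nat * (1 * (1 * 1)) + 0)))%C; [exact H|].
  ring.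
- pose proof (caratheodory_recurrence (S n)) as H; unfold circle_moment in H.
  rewrite !Cpow_1_l in H; simpl Nat.eqb in H; cbv iota in H.
  simpl in IH |- *.
  replace (a (S (S (S n))) + a (S (S n)))%C
    with ((2 * (a (S (S n)) * 1 + 0) + (a (S n) * 1 + 0) + (a (S (S (S n))) * 1 + 0))
          - (a (S (S n)) + a (S n)))%C by ring.
  rewrite H, IH; ring.
Qed.

(** Equality in Caratheodory's bound [|q'(0)| <= 2] is attained only by the Cayley
    transform (here with [q'(0) = -2]). *)
Lemma caratheodory_extremal (z : C) : in_disk z -> ((1 + z) * q z = 1 - z)%C.
Proof.
intros Hz.
pose proof (@is_pseries_plus C_AbsRing C_NormedModule _ _ z _ _ (Hq z Hz)
              (@is_pseries_incr_1 C_AbsRing C_NormedModule a z _ (Hq z Hz))) as Hm.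
assert (Hs : cpseries sum_consecutive z (q z + z * q z)%C).
{ eapply is_pseries_ext; [|exact Hm].
  intros [|n]; [|reflexivity].
  change (a 0%nat + 0 = a 0%nat)%C; ring. }
pose proof (is_Cpseries_unique _ _ _ _ Hs
  (is_Cpseries_quadratic _ z (fun n => sum_consecutive_vanish (S n)))) as H.
replace ((1 + z) * q z)%C with (q z + z * q z)%C by ring.
rewrite H, (sum_consecutive_vanish 0); simpl; rewrite Ha0, Ha1; ring.
Qed.

End Caratheodory.
(** * Injectivity from monotonicity on vertical lines *)

Lemma im_le_Cmod (c : C) : Rabs (Im c) <= Cmod c.
Proof. eapply Rle_trans; [apply Rmax_r|apply Rmax_Cmod]. Qed.

Lemma Cmod_le_re_im (c : C) : Cmod c <= Rabs (Re c) + Rabs (Im c).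
Proof.
replace c with (RtoC (Re c) + Ci * RtoC (Im c))%C at 1
  by (destruct c as [x y]; unfold RtoC, Ci, Cplus, Cmult; simpl; f_equal; ring).
eapply Rle_trans; [apply Cmod_triangle|].
rewrite Cmod_mult, Cmod_Ci, !Cmod_R; lra.
Qed.

(** A supremum argument: [U a < U s] cannot fail for the first time.  The local
    hypothesis compares values of [U] only with its value at [t], which can be
    checked along a level curve without differentiating the curve. *)
Lemma locally_increasing_lt (U : R -> R) (a b : R) :
  a < b ->
  (forall t, a <= t <= b -> exists d, 0 < d /\
     forall s, a <= s <= b -> Rabs (s - t) < d -> s <> t -> 0 < (U s - U t) * (s - t)) ->
  U a < U b.
Proof.
intros Hab Hloc.
assert (Hright : forall t, a <= t <= b -> exists d, 0 < d /\
  (forall s, a <= s <= b -> t < s < t + d -> U t < U s) /\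
  (forall s, a <= s <= b -> t - d < s < t -> U s < U t)).
{ intros t Ht; destruct (Hloc t Ht) as [d [Hd H]]; exists d; split; [exact Hd|]; split.
  - intros s Hs Hst.
    specialize (H s Hs ltac:(apply Rabs_def1; lra) ltac:(lra)); nra.
  - intros s Hs Hst.
    specialize (H s Hs ltac:(apply Rabs_def1; lra) ltac:(lra)); nra. }
set (E := fun t => a <= t <= b /\ forall s, a < s <= t -> U a < U s).
destruct (completeness E) as [T [HT1 HT2]].
{ exists b; intros t [Ht _]; lra. }
{ exists a; split; [lra|]; intros s Hs; lra. }
assert (HTa : a <= T) by (apply HT1; split; [lra|]; intros s Hs; lra).
assert (HTb : T <= b) by (apply HT2; intros t [Ht _]; lra).
assert (Hnear : forall s, s < T -> exists t, E t /\ s < t).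
{ intros s Hs; destruct (Classical_Prop.classic (exists t, E t /\ s < t)) as [H|H]; [exact H|].
  exfalso; assert (T <= s); [|lra].
  apply HT2; intros t Ht; apply Rnot_lt_le; intros Hlt; apply H; now exists t. }
destruct (Hright T ltac:(lra)) as [d [Hd [HR HL]]].
assert (HTE : forall s, a < s <= T -> U a < U s).
{ intros s Hs; destruct (Rlt_dec s T) as [Hlt|Hge].
  - destruct (Hnear s Hlt) as [t [[_ Ht] Hst]]; apply Ht; lra.
  - replace s with T by lra.
    destruct (Hnear (Rmax a (T - d))) as [t [[Ht Ht'] Hst]].
    { apply Rmax_lub_lt; lra. }
    assert (Ha' := Rle_lt_trans _ _ _ (Rmax_l _ _) Hst).
    assert (Hd' := Rle_lt_trans _ _ _ (Rmax_r _ _) Hst).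
    assert (HtT : t <= T) by (apply HT1; now split).
    destruct (Req_dec t T) as [->|Hne]; [apply Ht'; lra|].
    apply Rlt_trans with (U t); [apply Ht'; lra|apply HL; lra]. }
destruct (Rlt_dec T b) as [HTlt|HTge]; [exfalso|apply HTE; lra].
assert (Hmax : a <= Rmin b (T + d / 2) <= b /\ T < Rmin b (T + d / 2)
  /\ Rmin b (T + d / 2) < T + d).
{ pose proof (Rmin_l b (T + d / 2)); pose proof (Rmin_r b (T + d / 2)).
  assert (T < Rmin b (T + d / 2)) by (apply Rmin_glb_lt; lra); lra. }
set (T' := Rmin b (T + d / 2)) in *.
assert (T' <= T); [|lra].
apply HT1; split; [lra|]; intros s Hs.
destruct (Rle_dec s T) as [Hle|Hgt]; [apply HTE; lra|].
assert (U T < U s) by (apply HR; lra).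
destruct (Req_dec T a) as [<-|Hne]; [assumption|].
apply Rlt_trans with (U T); [apply HTE; lra|assumption].
Qed.

(** The derivative along a vertical line is [i l], whose imaginary part is
    [Re l]. *)
Lemma cderive_im_vertical (D : C -> C) (x y : R) (l : C) :
  cderive D (x, y) l -> is_derive (fun t : R => Im (D (x, t))) y (Re l).
Proof.
intros H; apply is_derive_Reals; intros eps He.
destruct (proj1 (cderive_iff _ _ _) H (eps / 2) ltac:(lra)) as [d [Hd HD]].
exists (mkposreal d Hd); intros h Hh Hhd; simpl in Hhd.
assert (Hw : ((x, (y + h)%R) - (x, y) = Ci * RtoC h)%C)
  by (unfold Cminus, Copp, Cplus, Cmult, Ci, RtoC; simpl; f_equal; ring).
specialize (HD (x, (y + h)%R)).
rewrite Hw, Cmod_mult, Cmod_Ci, Cmod_R, Rmult_1_l in HD.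
specialize (HD Hhd).
pose proof (Rle_trans _ _ _ (im_le_Cmod _) HD) as H1.
replace (Im (D (x, (y + h)%R) - D (x, y) - Ci * h * l)%C)
  with (Im (D (x, (y + h)%R)) - Im (D (x, y)) - h * Re l) in H1
  by (unfold Cminus, Copp, Cplus, Cmult, Ci, RtoC, Im, Re; simpl; ring).
replace ((Im (D (x, (y + h)%R)) - Im (D (x, y))) / h - Re l)
  with ((Im (D (x, (y + h)%R)) - Im (D (x, y)) - h * Re l) / h) by (field; exact Hh).
unfold Rdiv; rewrite Rabs_mult, Rabs_inv.
pose proof (Rabs_pos_lt h Hh).
apply (Rmult_lt_reg_r (Rabs h)); [assumption|].
rewrite Rmult_assoc, Rinv_l by lra; nra.
Qed.

Lemma cderive_continuous (D : C -> C) (z l : C) (eps : R) :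
  cderive D z l -> 0 < eps ->
  exists d, 0 < d /\ forall w, Cmod (w - z) < d -> Cmod (D w - D z) < eps.
Proof.
intros H He.
destruct (proj1 (cderive_iff _ _ _) H 1 ltac:(lra)) as [d [Hd HD]].
pose proof (Cmod_ge_0 l) as Hl.
exists (Rmin d (eps / (2 + Cmod l))); split.
{ apply Rmin_glb_lt; [exact Hd|apply Rdiv_lt_0_compat; lra]. }
intros w Hw.
specialize (HD w (Rlt_le_trans _ _ _ Hw (Rmin_l _ _))).
assert (H2 := Rlt_le_trans _ _ _ Hw (Rmin_r _ _)).
pose proof (proj2 (Rlt_div_r _ eps (2 + Cmod l) ltac:(lra)) H2) as H3.
pose proof (Cmod_triangle (D w - D z - (w - z) * l) ((w - z) * l)) as Ht.
replace (D w - D z - (w - z) * l + (w - z) * l)%C with (D w - D z)%C in Ht by ring.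
rewrite Cmod_mult in Ht; pose proof (Cmod_ge_0 (w - z)); nra.
Qed.

(** With [J = |p|^2 - |q|^2] the Jacobian, the differential
    [D |-> p D + conj (q D)] has inverse [s |-> (conj p s - conj q conj s) / J].
    A horizontal increment [s] of [A + conj B] is real, so to first order it comes
    from a displacement [D] with [J Re D = Re (p - q) s]: the signs of [s] and
    [Re D] agree. *)
Lemma harmonic_horizontal_increment (A B : C -> C) (z p q : C) :
  cderive A z p -> cderive B z q -> Cmod q < Cmod p -> 0 < Re (p - q) ->
  exists d, 0 < d /\ forall w, Cmod (w - z) < d -> Re w <> Re z ->
    Im (A w + Cconj (B w)) = Im (A z + Cconj (B z)) ->
    0 < (Re (A w + Cconj (B w)) - Re (A z + Cconj (B z))) * (Re w - Re z).
Proof.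
intros HA HB Hpq Hk.
set (k := Re (p - q)) in *.
pose proof (Cmod_ge_0 q) as Hq0.
set (J := Cmod p ^ 2 - Cmod q ^ 2).
assert (HJ : 0 < J) by (unfold J; nra).
set (T := Cmod p + Cmod q).
assert (HT : 0 < T) by (unfold T; lra).
set (L := Cmod (p - q)).
assert (HkL : k <= L)
  by (eapply Rle_trans; [apply Rle_abs|apply re_le_Cmod]).
(* [eta] is chosen so that the first-order errors change [J * Re D] by at most half
   of its main term [k * s] *)
set (eta := J * k / (8 * L * T)).
assert (Heta : 0 < eta) by (apply Rdiv_lt_0_compat; [nra|apply Rmult_lt_0_compat; lra]).
destruct (proj1 (cderive_iff _ _ _) HA eta Heta) as [d1 [Hd1 H1]].
destruct (proj1 (cderive_iff _ _ _) HB eta Heta) as [d2 [Hd2 H2]].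
exists (Rmin d1 d2); split; [now apply Rmin_glb_lt|].
intros w Hw Hre Him.
specialize (H1 w (Rlt_le_trans _ _ _ Hw (Rmin_l _ _))).
specialize (H2 w (Rlt_le_trans _ _ _ Hw (Rmin_r _ _))).
set (E1 := (A w - A z - (w - z) * p)%C) in *.
set (E2 := (B w - B z - (w - z) * q)%C) in *.
set (s := Re (A w + Cconj (B w)) - Re (A z + Cconj (B z))).
set (D := (w - z)%C) in *.
assert (Hs : RtoC s = (p * D + Cconj (q * D) + (E1 + Cconj E2))%C).
{ transitivity ((A w + Cconj (B w)) - (A z + Cconj (B z)))%C.
  - apply injective_projections; unfold s, Cminus; simpl; unfold Re, Im in *; simpl in *; lra.
  - unfold E1, E2; rewrite !Cminus_conj, !Cmult_conj; ring. }
set (rho := (Cconj p * (E1 + Cconj E2) - Cconj q * Cconj (E1 + Cconj E2))%C).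
assert (Hinv : (RtoC J * D = Cconj (p - q) * RtoC s - rho)%C).
{ assert (Hs' := f_equal Cconj Hs); rewrite Cconj_RtoC in Hs'.
  replace (Cconj (p - q) * RtoC s)%C with (Cconj p * RtoC s - Cconj q * RtoC s)%C
    by (rewrite Cminus_conj; ring).
  rewrite Hs' at 2; rewrite Hs; unfold rho, J.
  rewrite RtoC_minus, !Cmod2_conj, !Cplus_conj, !Cmult_conj, !Cconj_conj; ring. }
assert (Hrho : Cmod rho <= T * (2 * eta * Cmod D)).
{ assert (HE : Cmod (E1 + Cconj E2) <= 2 * eta * Cmod D).
  { eapply Rle_trans; [apply Cmod_triangle|]; rewrite Cmod_conj; lra. }
  unfold rho, Cminus; eapply Rle_trans; [apply Cmod_triangle|].
  rewrite Cmod_opp, !Cmod_mult, !Cmod_conj; unfold T.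
  rewrite Rmult_plus_distr_r; apply Rplus_le_compat; apply Rmult_le_compat_l;
    auto using Cmod_ge_0. }
assert (HTeta : T * (2 * eta) = J * k / (4 * L)) by (unfold eta; field; lra).
assert (HD0 : 0 <= Cmod D) by apply Cmod_ge_0.
assert (Hsmall : J * k / (4 * L) <= J / 4).
{ apply (proj2 (Rle_div_l (J * k) (J / 4) (4 * L) ltac:(lra))); nra. }
assert (Hmod : J * Cmod D <= L * Rabs s + Cmod rho).
{ replace (J * Cmod D) with (Cmod (RtoC J * D)) by (rewrite Cmod_mult, Cmod_R, Rabs_pos_eq; lra).
  rewrite Hinv; unfold Cminus; eapply Rle_trans; [apply Cmod_triangle|].
  fold (p - q)%C; rewrite Cmod_opp, Cmod_mult, Cmod_conj, Cmod_R; unfold L; lra. }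
assert (Hrho2 : Cmod rho <= J * k / (4 * L) * Cmod D) by (rewrite <- HTeta; lra).
assert (HDs : J * Cmod D <= 2 * L * Rabs s) by nra.
assert (Hrho3 : Cmod rho <= k / 2 * Rabs s).
{ eapply Rle_trans; [exact Hrho2|].
  replace (J * k / (4 * L) * Cmod D) with (k / (4 * L) * (J * Cmod D)) by (field; lra).
  replace (k / 2 * Rabs s) with (k / (4 * L) * (2 * L * Rabs s)) by (field; lra).
  apply Rmult_le_compat_l; [|exact HDs]. left; apply Rdiv_lt_0_compat; lra. }
assert (HreD : J * Re D = k * s - Re rho).
{ apply (f_equal Re) in Hinv; unfold Cminus in Hinv at 1.
  rewrite re_scal_l, re_plus, re_opp, re_scal_r, re_conj in Hinv.
  fold (p - q)%C in Hinv; fold k in Hinv; lra. }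
assert (Hrr := Rle_trans _ _ _ (re_le_Cmod rho) Hrho3).
assert (HDre : Re D = Re w - Re z) by (unfold D, Re, Cminus; simpl; ring).
rewrite <- HDre.
assert (HDne : Re D <> 0) by lra.
assert (Hs0 : s <> 0).
{ intros H0; rewrite H0, Rabs_R0, Rmult_0_r in Hrr.
  assert (Rabs (Re rho) = 0) by (apply Rle_antisym; [exact Hrr|apply Rabs_pos]).
  assert (Re rho = 0).
  { destruct (Req_dec (Re rho) 0) as [Hz|Hz]; [exact Hz|].
    pose proof (Rabs_pos_lt _ Hz); lra. }
  rewrite H0 in HreD; apply HDne; nra. }
assert (0 < k * s * s - Re rho * s).
{ assert (Re rho * s <= k / 2 * (s * s)).
  { eapply Rle_trans; [apply Rle_abs|]; rewrite Rabs_mult.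
    replace (s * s) with (Rabs s * Rabs s) by (rewrite <- Rabs_mult; apply Rabs_pos_eq; nra).
    pose proof (Rabs_pos s); nra. }
  assert (0 < s * s) by nra. nra. }
nra.
Qed.

(** A harmonic map [A + conj B] on the half-plane [Re z < sigma].  The lower bound
    [m] for [Re (A' - B')] on each vertical line makes the imaginary part not only
    increasing but onto on that line; this is what makes each level set of the
    imaginary part connected, being a graph over the whole interval. *)
Section VerticallyMonotone.

Variables (A B a b : C -> C) (sigma : R) (m : R -> R).
Hypothesis HA : forall z, Re z < sigma -> cderive A z (a z).
Hypothesis HB : forall z, Re z < sigma -> cderive B z (b z).
Hypothesis Hab : forall z, Re z < sigma -> Cmod (b z) < Cmod (a z).
Hypothesis Hm : forall x, x < sigma -> 0 < m x.
Hypothesis Hmab : forall z, Re z < sigma -> m (Re z) <= Re (a z - b z).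

Let F (z : C) : C := (A z + Cconj (B z))%C.

Lemma im_F (z : C) : Im (F z) = Im (A z - B z).
Proof. unfold F, Im, Cminus; simpl; ring. Qed.

Lemma vertical_is_derive (x y : R) : x < sigma ->
  is_derive (fun t : R => Im (F (x, t))) y (Re (a (x, y) - b (x, y))).
Proof.
intros Hx.
apply (is_derive_ext (fun t : R => Im (A (x, t) - B (x, t)))).
- intros t; symmetry; apply im_F.
- apply (cderive_im_vertical (fun z => A z - B z)%C).
  apply cderive_minus; [apply HA|apply HB]; exact Hx.
Qed.

Lemma vertical_growth (x y1 y2 : R) : x < sigma -> y1 <= y2 ->
  m x * (y2 - y1) <= Im (F (x, y2)) - Im (F (x, y1)).
Proof.
intros Hx Hy.
destruct (MVT_gen (fun t : R => Im (F (x, t))) y1 y2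
  (fun y => Re (a (x, y) - b (x, y)))) as [c [_ Hc]].
- intros y _; now apply vertical_is_derive.
- intros y _; apply derivable_continuous_pt.
  exists (Re (a (x, y) - b (x, y))); apply is_derive_Reals; now apply vertical_is_derive.
- rewrite Hc; apply Rmult_le_compat_r; [lra|]. apply (Hmab (x, c)); exact Hx.
Qed.

Lemma vertical_level (x c : R) : x < sigma -> {y : R | Im (F (x, y)) = c}.
Proof.
intros Hx.
set (v0 := Im (F (x, 0))).
set (Y := (Rabs c + Rabs v0) / m x).
pose proof (Hm x Hx) as Hm0.
assert (HY0 : 0 <= Y).
{ apply Rdiv_le_0_compat; [|exact Hm0].
  pose proof (Rabs_pos c); pose proof (Rabs_pos v0); lra. }
assert (HY : m x * Y = Rabs c + Rabs v0) by (unfold Y; field; lra).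
pose proof (vertical_growth x 0 Y Hx HY0) as H1.
pose proof (vertical_growth x (- Y) 0 Hx ltac:(lra)) as H2.
fold v0 in H1, H2.
pose proof (Rle_abs c); pose proof (Rle_abs v0).
pose proof (Rle_abs (- c)); pose proof (Rle_abs (- v0)).
rewrite Rabs_Ropp in *.
destruct (IVT_gen (fun t : R => Im (F (x, t))) (- Y) Y c) as [y [_ Hy]].
- intros y; apply derivable_continuous_pt.
  exists (Re (a (x, y) - b (x, y))); apply is_derive_Reals; now apply vertical_is_derive.
- rewrite Rmin_left, Rmax_right by lra; lra.
- now exists y.
Qed.

Lemma im_F_continuous (z : C) (eps : R) : Re z < sigma -> 0 < eps ->
  exists d, 0 < d /\ forall w, Cmod (w - z) < d -> Rabs (Im (F w) - Im (F z)) < eps.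
Proof.
intros Hz He.
destruct (cderive_continuous (fun w => A w - B w)%C z (a z - b z) eps) as [d [Hd H]];
  [apply cderive_minus; auto|exact He|].
exists d; split; [exact Hd|]; intros w Hw.
rewrite !im_F.
replace (Im (A w - B w) - Im (A z - B z)) with (Im ((A w - B w) - (A z - B z))%C)
  by (unfold Im, Cminus; simpl; ring).
eapply Rle_lt_trans; [apply im_le_Cmod|now apply H].
Qed.

(** The strict growth on the line through [x0] brackets the level, and the bracket
    persists on nearby lines. *)
Lemma level_continuous (x0 y0 eps : R) : x0 < sigma -> 0 < eps ->
  exists d, 0 < d /\ forall x y, x < sigma -> Rabs (x - x0) < d ->
    Im (F (x, y)) = Im (F (x0, y0)) -> Rabs (y - y0) < eps.
Proof.
intros Hx0 He.
pose proof (Hm x0 Hx0) as Hm0.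
assert (Hme : 0 < m x0 * eps) by nra.
pose proof (vertical_growth x0 y0 (y0 + eps) Hx0 ltac:(lra)) as Hup.
pose proof (vertical_growth x0 (y0 - eps) y0 Hx0 ltac:(lra)) as Hdn.
destruct (im_F_continuous (x0, (y0 + eps)%R) _ Hx0 Hme) as [d1 [Hd1 H1]].
destruct (im_F_continuous (x0, (y0 - eps)%R) _ Hx0 Hme) as [d2 [Hd2 H2]].
exists (Rmin d1 d2); split; [now apply Rmin_glb_lt|].
intros x y Hx Hd Hlev.
assert (Hdist : forall t, Cmod ((x, t) - (x0, t)) = Rabs (x - x0)).
{ intros t; rewrite <- Cmod_R; f_equal.
  unfold Cminus, Cplus, Copp, RtoC; simpl; f_equal; ring. }
specialize (H1 (x, (y0 + eps)%R)); rewrite Hdist in H1.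
specialize (H1 (Rlt_le_trans _ _ _ Hd (Rmin_l _ _))).
specialize (H2 (x, (y0 - eps)%R)); rewrite Hdist in H2.
specialize (H2 (Rlt_le_trans _ _ _ Hd (Rmin_r _ _))).
apply Rabs_def2 in H1; apply Rabs_def2 in H2.
pose proof (Hm x Hx) as Hmx.
apply Rabs_def1; apply Rnot_le_lt; intros Hle.
- pose proof (vertical_growth x (y0 + eps) y Hx ltac:(lra)); nra.
- pose proof (vertical_growth x y (y0 - eps) Hx ltac:(lra)); nra.
Qed.

(** Follow the level curve through [z], parametrised by the real part; it passes
    through [w], and [harmonic_horizontal_increment] applies at each of its
    points. *)
Lemma level_increasing (z w : C) :
  Re z < Re w -> Re w < sigma -> Im (F z) = Im (F w) -> Re (F z) < Re (F w).
Proof.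
intros Hlt Hw Him.
destruct z as [x1 y1]; destruct w as [x2 y2]; simpl in Hlt, Hw.
set (c := Im (F (x1, y1))).
assert (HY : forall x, {y : R | x < sigma -> Im (F (x, y)) = c}).
{ intros x; destruct (Rlt_dec x sigma) as [Hx|Hx].
  - destruct (vertical_level x c Hx) as [y Hy]; now exists y.
  - exists 0; intros; contradiction. }
set (Y := fun x => proj1_sig (HY x)).
assert (HYc : forall x, x < sigma -> Im (F (x, Y x)) = c)
  by (intros x; exact (proj2_sig (HY x))).
assert (Huniq : forall x y, x < sigma -> Im (F (x, y)) = c -> y = Y x).
{ intros x y Hx Hy; specialize (HYc x Hx); pose proof (Hm x Hx).
  destruct (Rtotal_order y (Y x)) as [Hl|[He|Hg]]; [exfalso|exact He|exfalso].
  - pose proof (vertical_growth x y (Y x) Hx ltac:(lra)); nra.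
  - pose proof (vertical_growth x (Y x) y Hx ltac:(lra)); nra. }
rewrite (Huniq x1 y1 ltac:(lra) eq_refl), (Huniq x2 y2 Hw (eq_sym Him)).
apply (locally_increasing_lt (fun x => Re (F (x, Y x)))); [exact Hlt|].
intros t Ht.
assert (Hts : t < sigma) by lra.
assert (Hpos : 0 < Re (a (t, Y t) - b (t, Y t)))
  by (eapply Rlt_le_trans; [apply (Hm t Hts)|apply (Hmab (t, Y t)); exact Hts]).
destruct (harmonic_horizontal_increment A B (t, Y t) _ _ (HA (t, Y t) Hts) (HB (t, Y t) Hts)
  (Hab (t, Y t) Hts) Hpos) as [d [Hd H]].
destruct (level_continuous t (Y t) (d / 2) Hts ltac:(lra)) as [d' [Hd' H']].
exists (Rmin (d / 2) d'); split; [apply Rmin_glb_lt; lra|].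
intros s Hs Hst Hne.
assert (Hss : s < sigma) by lra.
assert (Hlev : Im (F (s, Y s)) = Im (F (t, Y t))) by (rewrite !HYc by lra; reflexivity).
apply (H (s, Y s)); [|exact Hne|exact Hlev].
eapply Rle_lt_trans; [apply Cmod_le_re_im|].
assert (Hy := H' s (Y s) Hss (Rlt_le_trans _ _ _ Hst (Rmin_r _ _)) Hlev).
assert (Hx := Rlt_le_trans _ _ _ Hst (Rmin_l _ _)).
replace (Re ((s, Y s) - (t, Y t))%C) with (s - t) by (simpl; ring).
replace (Im ((s, Y s) - (t, Y t))%C) with (Y s - Y t) by (simpl; ring).
lra.
Qed.

Lemma vertically_monotone_injective (z w : C) :
  Re z < sigma -> Re w < sigma -> F z = F w -> z = w.
Proof.
intros Hz Hw HF.
destruct (Rtotal_order (Re z) (Re w)) as [Hlt|[Heq|Hgt]].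
- exfalso; pose proof (level_increasing z w Hlt Hw (f_equal Im HF)); rewrite HF in *; lra.
- destruct z as [x y1]; destruct w as [x' y2]; simpl in Heq, Hz; subst x'.
  f_equal; pose proof (Hm x Hz).
  destruct (Rle_dec y1 y2) as [Hle|Hle].
  + pose proof (vertical_growth x y1 y2 Hz Hle) as H1; rewrite HF in H1; nra.
  + pose proof (vertical_growth x y2 y1 Hz ltac:(lra)) as H1; rewrite HF in H1; nra.
- exfalso; pose proof (level_increasing w z Hgt Hz (f_equal Im (eq_sym HF)));
    rewrite HF in *; lra.
Qed.

End VerticallyMonotone.
(** * The disk and the half-plane *)

Lemma one_plus_neq_0 (u : C) : in_disk u -> (1 + u)%C <> 0%C.
Proof.
intros Hu H; unfold in_disk in Hu.
replace u with (- (1))%C in Hu by (replace u with ((1 + u) - 1)%C by ring; rewrite H; ring).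
rewrite Cmod_m1 in Hu; lra.
Qed.

(** The numerator of the real part is [1 - |u|^2]. *)
Lemma Re_cayley (u : C) : in_disk u -> 0 < Re ((1 - u) / (1 + u)).
Proof.
intros Hu; pose proof (one_plus_neq_0 u Hu) as H0.
assert (Hm : 0 < Cmod (1 + u)) by now apply Cmod_gt_0.
replace ((1 - u) / (1 + u))%C with (RtoC (/ Cmod (1 + u) ^ 2) * ((1 - u) * Cconj (1 + u)))%C.
- rewrite re_scal_l; apply Rmult_lt_0_compat; [apply Rinv_0_lt_compat; nra|].
  replace (Re ((1 - u) * Cconj (1 + u))%C) with (1 - Cmod u ^ 2)
    by (rewrite Cmod2_alt; unfold Re, Im; simpl; ring).
  pose proof (Cmod_ge_0 u); unfold in_disk in Hu; nra.
- assert (Cconj (1 + u) <> 0%C) by (apply Cmod_gt_0; now rewrite Cmod_conj).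
  rewrite RtoC_inv by nra; rewrite Cmod2_conj; field; auto.
Qed.

Lemma half_plane_to_disk (zeta : C) :
  Re zeta < 1 / 2 -> (1 - zeta)%C <> 0%C /\ in_disk (zeta / (1 - zeta)).
Proof.
intros Hz.
assert (H0 : (1 - zeta)%C <> 0%C).
{ intros H; apply (f_equal Re) in H; unfold Re in *; simpl in H; lra. }
split; [exact H0|]; unfold in_disk; rewrite Cmod_div by exact H0.
pose proof (proj1 (Cmod_gt_0 _) H0) as Hm.
apply (proj2 (Rlt_div_l _ _ _ Hm)); rewrite Rmult_1_l.
assert (Hsq : Cmod (1 - zeta) ^ 2 - Cmod zeta ^ 2 = 1 - 2 * Re zeta)
  by (rewrite !Cmod2_alt; unfold Re, Im; simpl; ring).
pose proof (Cmod_ge_0 zeta); nra.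
Qed.

Lemma disk_to_half_plane (z : C) : in_disk z -> Re (z / (1 + z)) < 1 / 2.
Proof.
intros Hz; pose proof (one_plus_neq_0 z Hz) as H0; pose proof (Re_cayley z Hz) as H.
replace ((1 - z) / (1 + z))%C with (RtoC 1 - RtoC 2 * (z / (1 + z)))%C in H by (field; auto).
unfold Cminus in H; rewrite re_plus, re_opp, re_scal_l, re_RtoC in H; lra.
Qed.

Lemma in_disk_dilatation (c z : C) (n : nat) :
  Cmod c = 1 -> n <> 0%nat -> in_disk z -> in_disk (c * z ^ n).
Proof.
unfold in_disk; intros Hc Hn Hz; rewrite Cmod_mult, Cmod_pow, Hc, Rmult_1_l.
pose proof (Cmod_ge_0 z); destruct n as [|n]; [lia|].
apply Rle_lt_trans with (Cmod z); [|exact Hz].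
assert (Cmod z ^ n <= 1) by (rewrite <- (pow1 n); apply pow_incr; lra).
simpl; nra.
Qed.

(** * The two parts of the Jacobian *)

(** What remains of the derivatives of the two parts of the convolution after a
    common factor is removed; [w] is the value of the dilatation at [z]. *)
Definition h_factor (n : nat) (z w : C) : C :=
  (2 + 2 * w - RtoC (INR n) * w * (1 + z))%C.
Definition g_factor (n : nat) (z w : C) : C :=
  (w * (2 * z * (1 + w) - RtoC (INR n) * (1 + z)))%C.

Lemma Cmod_lt_of_sq (u v : C) : Cmod u ^ 2 < Cmod v ^ 2 -> Cmod u < Cmod v.
Proof. pose proof (Cmod_ge_0 u); pose proof (Cmod_ge_0 v); nra. Qed.

(** Here [h_factor 1] is [2 + c z - c z^2], and [N] below is, up to a unimodular
    constant, its reciprocal polynomial [2 z^2 + conj c z - conj c]; the two have the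
    same modulus on the unit circle, whence the factor [1 - |z|^2] in the difference
    of squares.  The cofactor is at least [3 (1 - |z|)^2]. *)
Lemma factor_lt_1 (c z : C) : Cmod c = 1 -> in_disk z ->
  Cmod (g_factor 1 z (c * z ^ 1)) < Cmod (h_factor 1 z (c * z ^ 1)).
Proof.
intros Hc Hz; unfold in_disk in Hz; pose proof (Cmod_ge_0 z) as Hz0.
set (N := (1 - z - 2 * (c * z ^ 2))%C).
assert (Hg : Cmod (g_factor 1 z (c * z ^ 1)) = Cmod z * Cmod N).
{ replace (g_factor 1 z (c * z ^ 1)) with (- (c * (z * N)))%C
    by (unfold g_factor, N; simpl; ring).
  rewrite Cmod_opp, !Cmod_mult, Hc; ring. }
assert (Hdiff : Cmod (h_factor 1 z (c * z ^ 1)) ^ 2 - Cmod N ^ 2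
  = (1 - Cmod z ^ 2) * (3 * (1 + Cmod z ^ 2) + 4 * Re (c * z) + 2 * Re z)).
{ assert (Hc2 : Re c ^ 2 + Im c ^ 2 = 1) by (rewrite <- Cmod2_alt, Hc; ring).
  (* homogenised in [|c|^2] so that the identity holds for all [c] *)
  transitivity (4 + (Re c ^ 2 + Im c ^ 2) * (Cmod z ^ 2 + Cmod z ^ 4 - 2 * Cmod z ^ 2 * Re z)
    + 4 * Re (c * z) - 1 - Cmod z ^ 2 - 4 * (Re c ^ 2 + Im c ^ 2) * Cmod z ^ 4 + 2 * Re z
    - 4 * Cmod z ^ 2 * Re (c * z)); [|rewrite Hc2; ring].
  replace (Cmod z ^ 4) with ((Cmod z ^ 2) ^ 2) by ring.
  rewrite !Cmod2_alt; unfold h_factor, N, Re, Im; simpl; ring. }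
assert (H1 : - Cmod z <= Re z)
  by (pose proof (re_le_Cmod z) as H; apply Rabs_le_between in H; lra).
assert (H2 : - Cmod z <= Re (c * z)).
{ pose proof (re_le_Cmod (c * z)) as H; rewrite Cmod_mult, Hc in H.
  apply Rabs_le_between in H; lra. }
assert (Hpos : 0 < 3 * (1 + Cmod z ^ 2) + 4 * Re (c * z) + 2 * Re z) by nra.
apply Cmod_lt_of_sq; rewrite Hg.
assert (0 < (1 - Cmod z ^ 2) * (3 * (1 + Cmod z ^ 2) + 4 * Re (c * z) + 2 * Re z))
  by (apply Rmult_lt_0_compat; nra).
assert ((Cmod z * Cmod N) ^ 2 <= Cmod N ^ 2); [|lra].
rewrite Rpow_mult_distr; pose proof (pow2_ge_0 (Cmod N)).
assert (Cmod z ^ 2 <= 1) by nra. nra.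
Qed.

(** For [n = 2] the two factors differ by [- w]. *)
Lemma factor_lt_2 (z w : C) : in_disk z -> in_disk w ->
  Cmod (g_factor 2 z w) < Cmod (h_factor 2 z w).
Proof.
intros Hz Hw.
replace (g_factor 2 z w) with (- (w * h_factor 2 z w))%C
  by (unfold g_factor, h_factor; simpl; rewrite RtoC_plus; ring).
rewrite Cmod_opp, Cmod_mult.
assert (Hne : 0 < Cmod (h_factor 2 z w)).
{ apply Cmod_gt_0.
  replace (h_factor 2 z w) with (2 * (1 + - (z * w)))%C
    by (unfold h_factor; simpl; rewrite RtoC_plus; ring).
  apply Cmult_neq_0; [intros H; apply (f_equal fst) in H; simpl in H; lra|].
  apply one_plus_neq_0; unfold in_disk in *; rewrite Cmod_opp, Cmod_mult.
  pose proof (Cmod_ge_0 z); pose proof (Cmod_ge_0 w); nra. }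
unfold in_disk in Hw; nra.
Qed.

Lemma cderive_pow (z : C) (n : nat) :
  cderive (fun w => w ^ n)%C z (RtoC (INR n) * z ^ pred n)%C.
Proof.
induction n as [|n IH].
- replace (RtoC (INR 0) * z ^ pred 0)%C with (RtoC 0) by (simpl; ring).
  apply (cderive_const 1).
- replace (RtoC (INR (S n)) * z ^ pred (S n))%C
    with (1 * z ^ n + z * (RtoC (INR n) * z ^ pred n))%C.
  + apply (cderive_mult (fun w => w) (fun w => w ^ n)%C); [apply cderive_id|exact IH].
  + rewrite S_INR, RtoC_plus; destruct n as [|n]; simpl pred; [simpl; ring|].
    rewrite (Cpow_S z n); ring.
Qed.

(** * The convolution *)

Section ShearedHalfPlane.

Variables (f : harmonic) (n : nat) (c : C).
Hypothesis Hc : Cmod c = 1.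
Hypothesis Hn : n = 1%nat \/ n = 2%nat.
Hypothesis Hre : forall z, in_disk z -> Re (f z) < 1 / 2.
Hypothesis Hb1 : gcoef f 1%nat = RtoC 0.
Hypothesis Hsp : sense_preserving f.
Hypothesis Hdil : forall z, in_disk z -> dilatation f z = (c * z ^ n)%C.

Let omega (z : C) : C := (c * z ^ n)%C.

Lemma omega_in_disk (z : C) : in_disk z -> in_disk (omega z).
Proof. apply in_disk_dilatation; [exact Hc|lia]. Qed.

(** [caratheodory_extremal] for [q = 1 - 2 (h + g)]. *)
Lemma analytic_sum (z : C) : in_disk z -> (hpart f z + gpart f z = z / (1 + z))%C.
Proof.
intros Hz.
set (unit_coef := fun k : nat => RtoC (if Nat.eqb k 0 then 1 else 0)).
assert (Hq : sums_to_on_disk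
  (fun k => unit_coef k + RtoC (-2) * (hcoef f k + gcoef f k))%C
  (fun z => 1 + RtoC (-2) * (hpart f z + gpart f z))%C).
{ clear z Hz; intros z Hz.
  apply (@is_pseries_plus C_AbsRing C_NormedModule).
  - replace (RtoC 1) with (unit_coef 0%nat + z * unit_coef 1%nat + z ^ 2 * unit_coef 2%nat)%C
      by (unfold unit_coef; simpl; ring).
    apply is_Cpseries_quadratic; reflexivity.
  - apply (@is_pseries_scal C_AbsRing C_NormedModule); [apply Cmult_comm|].
    apply (@is_pseries_plus C_AbsRing C_NormedModule);
      [now apply hpart_series|now apply gpart_series]. }
pose proof (caratheodory_extremal _ _ Hq) as H.
assert (H' : ((1 + z) * (1 + RtoC (-2) * (hpart f z + gpart f z)) = 1 - z)%C).
{ apply H; [| | |exact Hz].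
  - intros w Hw; specialize (Hre w Hw).
    unfold harmonic_eval in Hre; rewrite re_plus, re_conj in Hre.
    rewrite re_plus, re_scal_l, re_plus, re_RtoC; lra.
  - unfold unit_coef; rewrite hcoef_0, gcoef_0; simpl; ring.
  - unfold unit_coef; rewrite hcoef_1, Hb1; simpl; ring. }
pose proof (one_plus_neq_0 z Hz) as H0.
replace (hpart f z + gpart f z)%C
  with ((1 + z - (1 + z) * (1 + RtoC (-2) * (hpart f z + gpart f z))) / (2 * (1 + z)))%C
  by (field; exact H0).
rewrite H'; field; exact H0.
Qed.

Let dh (z : C) : C := (1 / ((1 + z) * (1 + z) * (1 + omega z)))%C.

(** The two linear equations [h' + g' = 1 / (1 + z)^2] and [g' = omega h'] determine
    the derivatives. *)
Lemma analytic_derivatives (z : C) : in_disk z ->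
  cderive (hpart f) z (dh z) /\ cderive (gpart f) z (omega z * dh z)%C.
Proof.
intros Hz.
pose proof (sums_to_on_disk_cderive _ _ (hpart_series f) z Hz) as Hh.
pose proof (sums_to_on_disk_cderive _ _ (gpart_series f) z Hz) as Hg.
pose proof (one_plus_neq_0 z Hz) as H0.
pose proof (one_plus_neq_0 _ (omega_in_disk z Hz)) as Hw0.
assert (Hne : C_derive (hpart f) z <> 0%C).
{ apply Cmod_gt_0; pose proof (Hsp z Hz).
  pose proof (Cmod_ge_0 (C_derive (hpart f) z)); pose proof (Cmod_ge_0 (C_derive (gpart f) z)).
  nra. }
assert (Hgh : C_derive (gpart f) z = (omega z * C_derive (hpart f) z)%C).
{ unfold omega; rewrite <- (Hdil z Hz); unfold dilatation; field; exact Hne. }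
assert (Hsum : (C_derive (hpart f) z + C_derive (gpart f) z = 1 / ((1 + z) * (1 + z)))%C).
{ apply (cderive_unique (fun w => w / (1 + w))%C z).
  - apply (cderive_ext_loc (fun w => hpart f w + gpart f w)%C _ z _ (1 - Cmod z)).
    + unfold in_disk in Hz; lra.
    + intros w Hw; apply analytic_sum; now apply (in_disk_open z).
    + now apply cderive_plus.
  - replace (1 / ((1 + z) * (1 + z)))%C
      with ((1 * (1 + z) - z * (0 + 1)) / ((1 + z) * (1 + z)))%C by (field; exact H0).
    apply (cderive_div (fun w => w) (fun w => 1 + w)%C); [apply cderive_id| |exact H0].
    apply cderive_plus; [apply cderive_const|apply cderive_id]. }
rewrite Hgh in Hsum, Hg.
assert (Heq : C_derive (hpart f) z = dh z).
{ unfold dh.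
  replace (C_derive (hpart f) z)
    with ((C_derive (hpart f) z + omega z * C_derive (hpart f) z) / (1 + omega z))%C
    by (field; exact Hw0).
  rewrite Hsum; field; auto. }
rewrite Heq in Hh, Hg; now split.
Qed.

Let domega (z : C) : C := (c * (RtoC (INR n) * z ^ pred n))%C.

Lemma cderive_omega (z : C) : cderive omega z (domega z).
Proof.
replace (domega z) with (0 * z ^ n + c * (RtoC (INR n) * z ^ pred n))%C
  by (unfold domega; ring).
apply (cderive_mult (fun _ => c) (fun w => w ^ n)%C); [apply cderive_const|apply cderive_pow].
Qed.

Lemma z_domega (z : C) : (z * domega z = RtoC (INR n) * omega z)%C.
Proof.
unfold domega, omega; destruct Hn as [->| ->]; simpl; ring.
Qed.

Let ddh (z : C) : C :=
  (- ((2 * (1 + omega z) + (1 + z) * domega z)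
      / ((1 + z) * (1 + z) * (1 + z) * ((1 + omega z) * (1 + omega z)))))%C.

Lemma cderive_dh (z : C) : in_disk z -> cderive dh z (ddh z).
Proof.
intros Hz.
pose proof (one_plus_neq_0 z Hz) as H0.
pose proof (one_plus_neq_0 _ (omega_in_disk z Hz)) as Hw0.
assert (Hz1 : cderive (fun w => 1 + w)%C z (0 + 1)%C)
  by (apply cderive_plus; [apply cderive_const|apply cderive_id]).
assert (Hw1 : cderive (fun w => 1 + omega w)%C z (0 + domega z)%C)
  by (apply cderive_plus; [apply cderive_const|apply cderive_omega]).
pose proof (cderive_mult _ _ _ _ _ (cderive_mult _ _ _ _ _ Hz1 Hz1) Hw1) as HN.
assert (HN0 : ((1 + z) * (1 + z) * (1 + omega z))%C <> 0%C)
  by (repeat apply Cmult_neq_0; assumption).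
pose proof (cderive_div (fun _ => RtoC 1) _ z _ _ (cderive_const 1 z) HN HN0) as H.
cbv beta in H.
match type of H with is_derive _ _ ?l => replace (ddh z) with l; [exact H|] end.
unfold ddh; field; auto.
Qed.

(** The multiplier [(k + 1) / 2] acts as half the sum of the identity and
    [z d/dz]. *)
Lemma convolution_hpart (z : C) : in_disk z ->
  (hpart (convolution f0 f) z = (hpart f z + z * dh z) / 2)%C.
Proof.
intros Hz.
apply (is_Cpseries_unique (fun k => hcoef f0 k * hcoef f k)%C z);
  [exact (hpart_series (convolution f0 f) z Hz)|].
rewrite <- (is_C_derive_unique _ _ _ (proj1 (analytic_derivatives z Hz))).
pose proof (@is_pseries_plus C_AbsRing C_NormedModule _ _ z _ _ (hpart_series f z Hz)
  (@is_pseries_incr_1 C_AbsRing C_NormedModule _ z _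
    (cseries_derive_sum _ _ (hpart_series f) z Hz))) as H.
apply (@is_pseries_scal C_AbsRing C_NormedModule (RtoC (/ 2))) in H; [|apply Cmult_comm].
match type of H with is_pseries _ _ ?l => replace ((hpart f z + z * C_derive (hpart f) z) / 2)%C
  with l end.
- eapply is_pseries_ext; [|exact H].
  intros [|k].
  + change (RtoC (/ 2) * (hcoef f 0%nat + 0) = RtoC 0 * hcoef f 0%nat)%C.
    rewrite hcoef_0; ring.
  + change (RtoC (/ 2) * (hcoef f (S k) + RtoC (INR k + 1) * hcoef f (S k))
            = RtoC ((INR (S k) + 1) / 2) * hcoef f (S k))%C.
    rewrite S_INR; unfold Rdiv; rewrite RtoC_mult, !RtoC_plus; ring.
- change (RtoC (/ 2) * (hpart f z + z * C_derive (hpart f) z)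
          = (hpart f z + z * C_derive (hpart f) z) / 2)%C.
  rewrite RtoC_inv by lra; unfold Cdiv; ring.
Qed.

(** The multiplier [(1 - k) / 2] acts as half the difference of the identity and
    [z d/dz]. *)
Lemma convolution_gpart (z : C) : in_disk z ->
  (gpart (convolution f0 f) z = (gpart f z - z * (omega z * dh z)) / 2)%C.
Proof.
intros Hz.
apply (is_Cpseries_unique (fun k => gcoef f0 k * gcoef f k)%C z);
  [exact (gpart_series (convolution f0 f) z Hz)|].
rewrite <- (is_C_derive_unique _ _ _ (proj2 (analytic_derivatives z Hz))).
pose proof (@is_pseries_minus C_AbsRing C_NormedModule _ _ z _ _ (gpart_series f z Hz)
  (@is_pseries_incr_1 C_AbsRing C_NormedModule _ z _
    (cseries_derive_sum _ _ (gpart_series f) z Hz))) as H.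
apply (@is_pseries_scal C_AbsRing C_NormedModule (RtoC (/ 2))) in H; [|apply Cmult_comm].
match type of H with is_pseries _ _ ?l => replace ((gpart f z - z * C_derive (gpart f) z) / 2)%C
  with l end.
- eapply is_pseries_ext; [|exact H].
  intros [|k].
  + change (RtoC (/ 2) * (gcoef f 0%nat - 0) = RtoC 0 * gcoef f 0%nat)%C.
    rewrite gcoef_0; ring.
  + change (RtoC (/ 2) * (gcoef f (S k) - RtoC (INR k + 1) * gcoef f (S k))
            = RtoC ((1 - INR (S k)) / 2) * gcoef f (S k))%C.
    rewrite S_INR; unfold Rdiv; rewrite RtoC_mult, RtoC_minus, !RtoC_plus; ring.
- change (RtoC (/ 2) * (gpart f z - z * C_derive (gpart f) z)
          = (gpart f z - z * C_derive (gpart f) z) / 2)%C.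
  rewrite RtoC_inv by lra; unfold Cdiv; ring.
Qed.

Let common_factor (z : C) : C :=
  (1 / (2 * ((1 + z) * (1 + z) * (1 + z) * ((1 + omega z) * (1 + omega z)))))%C.

Let dH (z : C) : C := (common_factor z * h_factor n z (omega z))%C.
Let dG (z : C) : C := (common_factor z * g_factor n z (omega z))%C.

Lemma cderive_convolution_hpart (z : C) : in_disk z ->
  cderive (hpart (convolution f0 f)) z (dH z).
Proof.
intros Hz.
pose proof (one_plus_neq_0 z Hz) as H0.
pose proof (one_plus_neq_0 _ (omega_in_disk z Hz)) as Hw0.
apply (cderive_ext_loc (fun w => (hpart f w + w * dh w) * / 2)%C _ z _ (1 - Cmod z)).
- unfold in_disk in Hz; lra.
- intros w Hw; symmetry; apply convolution_hpart; now apply (in_disk_open z).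
- pose proof (cderive_mult _ _ _ _ _ (cderive_plus _ _ _ _ _
    (proj1 (analytic_derivatives z Hz))
    (cderive_mult _ _ _ _ _ (cderive_id z) (cderive_dh z Hz))) (cderive_const (/ 2) z)) as H.
  cbv beta in H.
  match type of H with is_derive _ _ ?l => replace (dH z) with l; [exact H|] end.
  unfold dH, common_factor, h_factor, dh, ddh.
  replace (RtoC (INR n) * omega z * (1 + z))%C with (z * domega z * (1 + z))%C
    by (rewrite z_domega; ring).
  field; auto.
Qed.

Lemma cderive_convolution_gpart (z : C) : in_disk z ->
  cderive (gpart (convolution f0 f)) z (dG z).
Proof.
intros Hz.
pose proof (one_plus_neq_0 z Hz) as H0.
pose proof (one_plus_neq_0 _ (omega_in_disk z Hz)) as Hw0.
apply (cderive_ext_loc (fun w => (gpart f w - w * (omega w * dh w)) * / 2)%C _ z _ (1 - Cmod z)).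
- unfold in_disk in Hz; lra.
- intros w Hw; symmetry; apply convolution_gpart; now apply (in_disk_open z).
- pose proof (cderive_mult _ _ _ _ _ (cderive_minus _ _ _ _ _
    (proj2 (analytic_derivatives z Hz))
    (cderive_mult _ _ _ _ _ (cderive_id z)
      (cderive_mult _ _ _ _ _ (cderive_omega z) (cderive_dh z Hz)))) (cderive_const (/ 2) z)) as H.
  cbv beta in H.
  match type of H with is_derive _ _ ?l => replace (dG z) with l; [exact H|] end.
  unfold dG, common_factor, g_factor, dh, ddh.
  replace (omega z * (2 * z * (1 + omega z) - RtoC (INR n) * (1 + z)))%C
    with (omega z * (2 * z * (1 + omega z)) - z * domega z * (1 + z))%C
    by (rewrite z_domega; ring).
  field; auto.
Qed.

Lemma convolution_jacobian (z : C) : in_disk z -> Cmod (dG z) < Cmod (dH z).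
Proof.
intros Hz.
pose proof (one_plus_neq_0 z Hz) as H0.
pose proof (one_plus_neq_0 _ (omega_in_disk z Hz)) as Hw0.
assert (H2 : RtoC 2 <> 0%C) by (intros H; apply (f_equal fst) in H; simpl in H; lra).
unfold dG, dH; rewrite !Cmod_mult; apply Rmult_lt_compat_l.
- unfold common_factor; rewrite Cmod_div by (repeat apply Cmult_neq_0; assumption).
  rewrite Cmod_1; apply Rdiv_lt_0_compat; [lra|].
  apply Cmod_gt_0; repeat apply Cmult_neq_0; assumption.
- pose proof (omega_in_disk z Hz) as Hw; unfold omega in *.
  destruct Hn as [->| ->]; [now apply factor_lt_1|now apply factor_lt_2].
Qed.

(** Both quotients on the right have positive real part, and
    [dz/dzeta = (1 + z)^2], so this is the derivative of [H - G] in the coordinate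
    [zeta = z / (1 + z)]. *)
Lemma convolution_derivative_gap (z : C) : in_disk z ->
  ((dH z - dG z) * ((1 + z) * (1 + z))
   = RtoC (/ 2) * ((1 - omega z) / (1 + omega z) + (1 - z) / (1 + z)))%C.
Proof.
intros Hz.
pose proof (one_plus_neq_0 z Hz) as H0.
pose proof (one_plus_neq_0 _ (omega_in_disk z Hz)) as Hw0.
unfold dH, dG, common_factor, h_factor, g_factor; rewrite RtoC_inv by lra.
field; auto.
Qed.

Lemma cderive_half_plane_to_disk (zeta : C) : (1 - zeta)%C <> 0%C ->
  cderive (fun w => w / (1 - w))%C zeta (1 / ((1 - zeta) * (1 - zeta)))%C.
Proof.
intros H0.
replace (1 / ((1 - zeta) * (1 - zeta)))%C
  with ((1 * (1 - zeta) - zeta * (0 - 1)) / ((1 - zeta) * (1 - zeta)))%C by (field; exact H0).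
apply (cderive_div (fun w => w) (fun w => 1 - w)%C); [apply cderive_id| |exact H0].
apply cderive_minus; [apply cderive_const|apply cderive_id].
Qed.

Lemma convolution_univalent : univalent (convolution f0 f).
Proof.
intros z w Hz Hw Hzw.
set (T := fun zeta : C => (zeta / (1 - zeta))%C).
assert (HT : forall u, in_disk u -> T (u / (1 + u))%C = u).
{ intros u Hu; pose proof (one_plus_neq_0 u Hu) as H0; unfold T.
  assert (H1 : (1 + u - u)%C <> 0%C).
  { replace (1 + u - u)%C with (RtoC 1) by ring; intros H; apply (f_equal fst) in H.
    simpl in H; lra. }
  field; auto. }
assert (Heq : (z / (1 + z) = w / (1 + w))%C).
{ apply (vertically_monotone_injective
    (fun zeta => hpart (convolution f0 f) (T zeta)) (fun zeta => gpart (convolution f0 f) (T zeta))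
    (fun zeta => dH (T zeta) * (1 / ((1 - zeta) * (1 - zeta))))%C
    (fun zeta => dG (T zeta) * (1 / ((1 - zeta) * (1 - zeta))))%C
    (* the bound comes from [(1 - z) / (1 + z) = 1 - 2 zeta] *)
    (1 / 2) (fun x => (1 - 2 * x) / 2)).
  - intros zeta Hzeta; destruct (half_plane_to_disk zeta Hzeta) as [H0 Hd].
    apply (cderive_comp (hpart (convolution f0 f)) T);
      [now apply cderive_convolution_hpart|now apply cderive_half_plane_to_disk].
  - intros zeta Hzeta; destruct (half_plane_to_disk zeta Hzeta) as [H0 Hd].
    apply (cderive_comp (gpart (convolution f0 f)) T);
      [now apply cderive_convolution_gpart|now apply cderive_half_plane_to_disk].
  - intros zeta Hzeta; destruct (half_plane_to_disk zeta Hzeta) as [H0 Hd].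
    rewrite !Cmod_mult; apply Rmult_lt_compat_r; [|now apply convolution_jacobian].
    assert (H1 : ((1 - zeta) * (1 - zeta))%C <> 0%C) by now apply Cmult_neq_0.
    rewrite Cmod_div, Cmod_1 by exact H1.
    apply Rdiv_lt_0_compat; [lra|now apply Cmod_gt_0].
  - intros x Hx; lra.
  - intros zeta Hzeta; destruct (half_plane_to_disk zeta Hzeta) as [H0 Hd].
    pose proof (convolution_derivative_gap (T zeta) Hd) as H.
    assert (H1 : (1 + T zeta = 1 / (1 - zeta))%C) by (unfold T; field; exact H0).
    assert (H2 : ((1 - T zeta) / (1 + T zeta) = 1 - 2 * zeta)%C).
    { rewrite H1; unfold T; field; auto. }
    rewrite H2 in H.
    replace (dH (T zeta) * (1 / ((1 - zeta) * (1 - zeta))) -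
             dG (T zeta) * (1 / ((1 - zeta) * (1 - zeta))))%C
      with ((dH (T zeta) - dG (T zeta)) * ((1 + T zeta) * (1 + T zeta)))%C
      by (rewrite H1; field; exact H0).
    rewrite H, re_scal_l, re_plus.
    pose proof (Re_cayley _ (omega_in_disk _ Hd)) as Hpos; fold (T zeta) in Hpos.
    replace (Re (1 - 2 * zeta)%C) with (1 - 2 * Re zeta)
      by (unfold Cminus; rewrite re_plus, re_opp, re_scal_l, re_RtoC; ring).
    lra.
  - now apply disk_to_half_plane.
  - now apply disk_to_half_plane.
  - rewrite !HT by assumption; exact Hzw. }
rewrite <- (HT z Hz), <- (HT w Hw), Heq; reflexivity.
Qed.

Lemma convolution_S_H0 : S_H0 (convolution f0 f).
Proof.
split; [split|].
- exact convolution_univalent.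
- intros z Hz.
  rewrite (is_C_derive_unique _ _ _ (cderive_convolution_hpart z Hz)).
  rewrite (is_C_derive_unique _ _ _ (cderive_convolution_gpart z Hz)).
  pose proof (convolution_jacobian z Hz); pose proof (Cmod_ge_0 (dG z)); nra.
- simpl; rewrite Hb1; ring.
Qed.

End ShearedHalfPlane.

Theorem corollary1 (f : harmonic) (n : nat) (theta : R)
    (hn : n = 1%nat \/ n = 2%nat)
    (hf : S0_halfplane PI f)
    (hdil : forall z : C, in_disk z ->
       dilatation f z = (expi theta * z ^ n)%C) :
  S_H0 (convolution f0 f).
Proof.
destruct hf as [[[_ Hsp] Hb1] Hrange].
apply (convolution_S_H0 f n (expi theta)); try assumption; [apply Cmod_expi|].
intros z Hz; apply halfplane_PI, Hrange; now exists z.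
Qed.
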